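(* Let $u$ be a smooth solution of the incompressible Navier--Stokes equations on $\mathbb{T}^3\times[0,T]$ with initial datum $u_0$ and viscosity $\nu>0$. Fix a time $t\in[0,T]$ and let $J,\widetilde J,M,Q,\mathcal R$ be the associated fields at time $t$, defined in the context. Let $\sigma_J:=\sup_x(\operatorname{tr}Q(x))^{1/2}$ and $L_J:=\sup_x(\mathbb{E}|J(x)|_{\mathrm F}^2)^{1/2}$, and for $0<\beta\le1$ set $$\mathsf H_{J,\beta}:=\sup_{x\ne y}\frac{\bigl(\mathbb{E}|\widetilde J(x)-\widetilde J(y)|_{\mathrm F}^2\bigr)^{1/2}}{d(x,y)^\beta},$$ where $d$ is the geodesic distance on $\mathbb{T}^3$. Then $L_J\le\sigma_J+\sqrt3\,\|M\|_{L^\infty}$, $$\|\mathcal R\|_{L^\infty}\le\|u_0\|_{L^\infty}\,\sigma_J,$$ and there is a dimensional constant $C$ such that $$\|\mathcal R\|_{C^\beta}\le C\Big[\|u_0\|_{L^\infty}(\sigma_J+\mathsf H_{J,\beta})+\|\nabla u_0\|_{L^\infty}\,\sigma_J\bigl(\sigma_J+\sqrt3\,\|M\|_{L^\infty}\bigr)\Big].$$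
   Context: $\mathbb{T}^3=\mathbb{R}^3/\mathbb{Z}^3$, $\nu>0$. $u$ is a classical solution, smooth on $\mathbb{T}^3\times[0,T]$, of $\partial_tu+(u\cdot\nabla)u-\nu\Delta u+\nabla p=0$, $\operatorname{div}u=0$, $u(0)=u_0$. The stochastic flow is $\mathrm{d}X_t(a)=u(t,X_t(a))\,\mathrm{d}t+\sqrt{2\nu}\,\mathrm{d}W_t$, $X_0(a)=a$, with a single 3-dimensional Brownian motion $W$ common to all labels $a$; almost surely $X_t$ is a smooth volume-preserving diffeomorphism, and $A_t:=X_t^{-1}$. Matrix convention: $(\nabla v)_{ij}=\partial_jv_i$; matrix norms are operator norms unless the Frobenius norm $|\cdot|_{\mathrm F}$ is indicated. Define $J:=\nabla A_t$, $V:=u_0\circ A_t$, $M:=\mathbb{E}J$, $N:=\mathbb{E}V$ (expectations pointwise in $x$), $\widetilde J:=J-M$, $Q:=\mathbb{E}[\widetilde J^\top\widetilde J]$ (so $\operatorname{tr}Q=\mathbb{E}|\widetilde J|_{\mathrm F}^2$), and $\mathcal R:=\mathbb{E}[J^\top V]-M^\top N=\mathbb{E}[(J-M)^\top(V-N)]$. The norm $\|\cdot\|_{C^\beta}$ is the sup norm plus the $\beta$-Hölder seminorm with respect to $d$ (Lipschitz seminorm if $\beta=1$). *)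

(* Defs.v *)
From HB Require Import structures.
From mathcomp Require Export all_boot all_order all_algebra.
From mathcomp Require Export all_classical all_reals all_analysis.
Set Implicit Arguments.
Unset Strict Implicit.
Unset Printing Implicit Defensive.
Import Order.TTheory GRing.Theory Num.Theory.
Import numFieldNormedType.Exports.
Local Open Scope classical_set_scope.
Local Open Scope ring_scope.

(* Fields on the torus R^3/Z^3 are represented by their Z^3-periodic lifts to
   R^3, and self-maps of the torus by lifts commuting with Z^3-translations.
   Vectors are columns; the norm that the library puts on matrices is the max
   norm (used here only through its topology), hence frob below. *)

Section Norms.
Variable R : realType.

(* Frobenius norm; Euclidean norm on column vectors *)
Definition frob m n (A : 'M[R]_(m, n)) : R :=
  Num.sqrt (\sum_i \sum_j A i j ^+ 2).

Definition opnorm m n (A : 'M[R]_(m, n)) : R :=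
  sup [set frob (A *m v) | v in [set v : 'cV[R]_n | frob v <= 1]].

End Norms.

Section Torus.
Variable R : realType.
Local Notation R3 := 'cV[R]_3.

Definition Zvec (k : 'cV[int]_3) : R3 := map_mx intr k.

Definition torus_eq (x y : R3) := exists k, x = y + Zvec k.

Definition periodic (S : Type) (f : R3 -> S) :=
  forall x k, f (x + Zvec k) = f x.

Definition torus_map (f : R3 -> R3) :=
  forall x k, f (x + Zvec k) = f x + Zvec k.

(* geodesic distance of the flat torus *)
Definition tdist (x y : R3) : R := inf (range (fun k => frob (x - y - Zvec k))).

(* L^oo norm of a (continuous) field, the pointwise norm being nrm *)
Definition supnorm (S : Type) (nrm : S -> R) (f : R3 -> S) : \bar R :=
  ereal_sup (range (fun x => (nrm (f x))%:E)).

Definition holder_seminorm (b : R) (f : R3 -> R3) : \bar R :=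
  ereal_sup [set (frob (f z.1 - f z.2) / tdist z.1 z.2 `^ b)%:E |
             z in [set z : R3 * R3 | ~ torus_eq z.1 z.2]].

Definition holder_norm (b : R) (f : R3 -> R3) : \bar R :=
  (supnorm (@frob R 3 1) f + holder_seminorm b f)%E.

End Torus.

Section Calculus.
Variable R : realType.
Local Notation R3 := 'cV[R]_3.

Fixpoint Cn_on (E F : normedModType R) (n : nat) (U : set E) (f : E -> F) : Prop :=
  match n with
  | 0 => forall x, U x -> {for x, continuous f}
  | n'.+1 => (forall x, U x -> differentiable f x) /\
             (forall v, Cn_on n' U (fun x => 'D_v f x))
  end.

(* C^oo on an arbitrary set: C^oo on some open neighbourhood of it *)
Definition smooth_on (E F : normedModType R) (D : set E) (f : E -> F) :=
  exists U : set E, [/\ open U, D `<=` U & forall n, Cn_on n U f].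

Definition pd (j : 'I_3) (f : R3 -> R) (x : R3) : R :=
  'D_(delta_mx j 0) (f : R3 -> R^o) x.

Definition grad (v : R3 -> R3) (x : R3) : 'M[R]_3 :=
  \matrix_(i, j) pd j (fun y => v y i 0) x.

Definition sgrad (p : R3 -> R) (x : R3) : R3 := \col_i pd i p x.

Definition divergence (v : R3 -> R3) (x : R3) : R := \tr (grad v x).

Definition laplacian (v : R3 -> R3) (x : R3) : R3 :=
  \col_i \sum_j pd j (pd j (fun y => v y i 0)) x.

Definition dt (u : R -> R3 -> R3) (t : R) (x : R3) : R3 :=
  'D_1 ((fun s => u s x) : R^o -> R3) t.

(* u is a field on the whole line of times, only constrained near [0, T];
   grad (u t) x *m u t x is the transport term (u . grad) u. *)
Definition navier_stokes (nu T : R) (u0 : R3 -> R3) (u : R -> R3 -> R3) :=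
  [/\ smooth_on [set z : R^o * R3 | 0 <= (z.1 : R) <= T] (fun z => u z.1 z.2),
      forall t, 0 <= t <= T -> periodic (u t),
      exists p : R -> R3 -> R, forall t, 0 <= t <= T ->
        [/\ periodic (p t),
            forall x, differentiable (p t : R3 -> R^o) x &
            forall x, dt u t x + grad (u t) x *m u t x
                      - nu *: laplacian (u t) x + sgrad (p t) x = 0],
      forall t x, 0 <= t <= T -> divergence (u t) x = 0 &
      forall x, u 0 x = u0 x].

Definition volume_preserving (f : R3 -> R3) :=
  forall x, \det (grad f x) = 1.

Definition smooth_vp_diffeo (f : R3 -> R3) :=
  [/\ torus_map f, smooth_on setT f, volume_preserving f &
      exists g, [/\ cancel f g, cancel g f & smooth_on setT g]].

End Calculus.

Section Stochastic.
Variables (R : realType) (d : measure_display) (Omega : measurableType d).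
Variable P : probability Omega R.
Local Notation R3 := 'cV[R]_3.

Definition random_vector (Y : Omega -> R3) :=
  forall i, measurable_fun setT (fun w => Y w i 0).

(* The second argument of normal_prob is the standard deviation.  The last
   clause says at once that the coordinates of the increments over successive
   intervals are centred Gaussian of variance the length of the interval, and
   that all of them are mutually independent. *)
Definition brownian (W : R -> Omega -> R3) :=
  [/\ forall t, 0 <= t -> random_vector (W t),
      {ae P, forall w, W 0 w = 0},
      {ae P, forall w, {within `[0, +oo[, continuous (fun t => W t w)}} &
      forall (n : nat) (t : nat -> R) (B : 'I_n -> 'I_3 -> set R),
        0 <= t 0 -> (forall k, t k < t k.+1) ->
        (forall k i, measurable (B k i)) ->
        P [set w | forall (k : 'I_n) i, B k i (W (t k.+1) w i 0 - W (t k) w i 0)]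
        = (\prod_(k < n) \prod_(i < 3)
             normal_prob 0 (Num.sqrt (t k.+1 - t k)) (B k i))%E].

(* The noise is additive, so the equation
   dX = u(t, X) dt + sqrt(2 nu) dW, X_0 = id, contains no stochastic integral. *)
Definition stochastic_flow (nu T : R) (u : R -> R3 -> R3)
    (W : R -> Omega -> R3) (X : R -> Omega -> R3 -> R3) :=
  [/\ forall t a, 0 <= t <= T -> random_vector (fun w => X t w a),
      {ae P, forall w, forall a,
         {within `[0, T], continuous (fun t => X t w a)} /\
         forall t, 0 <= t <= T ->
           X t w a = a
             + \col_i (\int[lebesgue_measure]_(s in `[0, t]) u s (X s w a) i 0)
             + Num.sqrt (2 * nu) *: W t w} &
      forall t, 0 <= t <= T -> {ae P, forall w, smooth_vp_diffeo (X t w)}].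

Definition inverse_flow (T : R) (X A : R -> Omega -> R3 -> R3) :=
  forall t, 0 <= t <= T ->
    (forall x, random_vector (fun w => A t w x)) /\
    {ae P, forall w, cancel (X t w) (A t w) /\ cancel (A t w) (X t w)}.

Definition Ex (f : Omega -> R) : R := fine 'E_P[f].

Definition Emx m n (Y : Omega -> 'M[R]_(m, n)) : 'M[R]_(m, n) :=
  \matrix_(i, j) Ex (fun w => Y w i j).

Section Fields.
Variables (u0 : R3 -> R3) (At : Omega -> R3 -> R3).

Definition Jf (x : R3) (w : Omega) : 'M[R]_3 := grad (At w) x.
Definition Vf (x : R3) (w : Omega) : R3 := u0 (At w x).
Definition Mf (x : R3) : 'M[R]_3 := Emx (Jf x).
Definition Nf (x : R3) : R3 := Emx (Vf x).
Definition Jtilde (x : R3) (w : Omega) : 'M[R]_3 := Jf x w - Mf x.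
Definition Qf (x : R3) : 'M[R]_3 := Emx (fun w => (Jtilde x w)^T *m Jtilde x w).
Definition calR (x : R3) : R3 :=
  Emx (fun w => (Jf x w)^T *m Vf x w) - (Mf x)^T *m Nf x.

Definition sigmaJ : \bar R :=
  ereal_sup (range (fun x => (Num.sqrt (\tr (Qf x)))%:E)).

Definition LJ : \bar R :=
  ereal_sup (range (fun x => (Num.sqrt (Ex (fun w => frob (Jf x w) ^+ 2)))%:E)).

Definition HJ (b : R) : \bar R :=
  ereal_sup
    [set (Num.sqrt (Ex (fun w => frob (Jtilde z.1 w - Jtilde z.2 w) ^+ 2))
          / tdist z.1 z.2 `^ b)%:E |
     z in [set z : R3 * R3 | ~ torus_eq z.1 z.2]].

End Fields.

End Stochastic.

(* Main.v *)
(* Since E[Jtilde] = 0, R = E[Jtilde^T V], and its sup bound is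
   the Cauchy-Schwarz inequality in L^2 of matrix-valued random variables.  For
   the Hoelder bound,
     R(x) - R(y) = E[(Jtilde x - Jtilde y)^T V(x)] + E[Jtilde(y)^T (V(x) - V(y))],
   where |V(x) - V(y)| <= |grad u0| |A(x) - A(y)| and the L^2 norm of
   A(x) - A(y) is at most L_J |x - y|; any representative of y modulo Z^3 may be
   used, so |x - y| may be replaced by the geodesic distance, which is at most 1.

   All expectations are finite because the noise is additive: it cancels in
   X(a) - X(b), so that Gronwall's inequality run backwards in time bounds the
   Lipschitz constant of A_t by a deterministic number.  The null set where
   A_t is not regular is removed beforehand, by replacing A_t by the identity
   there; J need not be measurable on it, but an expectation does not see a
   modification on a null set even for nonmeasurable integrands. *)
Require Import Defs.
From mathcomp Require Import measurable_realfun ring lra.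
Set Implicit Arguments.
Unset Strict Implicit.
Unset Printing Implicit Defensive.
Import Order.TTheory GRing.Theory Num.Theory.
Import numFieldNormedType.Exports.
Local Open Scope classical_set_scope.
Local Open Scope ring_scope.

(** * Frobenius and operator norms *)

Section Frobenius.
Variable R : realType.

(** Frobenius inner product; [frob] is its norm by mere conversion. *)
Definition mxdot m n (A B : 'M[R]_(m, n)) : R := \sum_i \sum_j A i j * B i j.

Lemma mxdotC m n (A B : 'M[R]_(m, n)) : mxdot A B = mxdot B A.
Proof. by apply: eq_bigr => i _; apply: eq_bigr => j _; rewrite mulrC. Qed.

Lemma mxdotDl m n (A B C : 'M[R]_(m, n)) :
  mxdot (A + B) C = mxdot A C + mxdot B C.
Proof.
rewrite -big_split/=; apply: eq_bigr => i _; rewrite -big_split/=.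
by apply: eq_bigr => j _; rewrite mxE mulrDl.
Qed.

Lemma mxdotZl m n a (A C : 'M[R]_(m, n)) : mxdot (a *: A) C = a * mxdot A C.
Proof.
rewrite mulr_sumr; apply: eq_bigr => i _; rewrite mulr_sumr.
by apply: eq_bigr => j _; rewrite mxE mulrA.
Qed.

Lemma mxdotNl m n (A C : 'M[R]_(m, n)) : mxdot (- A) C = - mxdot A C.
Proof. by rewrite -scaleN1r mxdotZl mulN1r. Qed.

Lemma mxdotBl m n (A B C : 'M[R]_(m, n)) :
  mxdot (A - B) C = mxdot A C - mxdot B C.
Proof. by rewrite mxdotDl mxdotNl. Qed.

Lemma mxdotDr m n (A B C : 'M[R]_(m, n)) :
  mxdot C (A + B) = mxdot C A + mxdot C B.
Proof. by rewrite mxdotC mxdotDl !(mxdotC C). Qed.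

Lemma mxdotZr m n a (A C : 'M[R]_(m, n)) : mxdot C (a *: A) = a * mxdot C A.
Proof. by rewrite mxdotC mxdotZl mxdotC. Qed.

Lemma mxdot_ge0 m n (A : 'M[R]_(m, n)) : 0 <= mxdot A A.
Proof. by apply: sumr_ge0 => i _; apply: sumr_ge0 => j _; rewrite -expr2 sqr_ge0. Qed.

Lemma mxdot_trace m n (A B : 'M[R]_(m, n)) : mxdot A B = \tr (A^T *m B).
Proof.
rewrite /mxdot exchange_big/=; apply: eq_bigr => j _; rewrite mxE.
by apply: eq_bigr => i _; rewrite mxE.
Qed.

Lemma mxdot_mulmx m n p (A : 'M[R]_(m, n)) (B : 'M[R]_(n, p)) (C : 'M[R]_(m, p)) :
  mxdot (A *m B) C = mxdot A (C *m B^T).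
Proof. by rewrite !mxdot_trace trmx_mul -mulmxA mxtrace_mulC mulmxA. Qed.

(** For [p = 1], testing [A^T *m B] against a vector becomes a pairing of [A] with a rank-one
    matrix, whose Frobenius norm factorizes ([frob_mul_tr]). *)
Lemma mxdot_trmulmx m n p (A : 'M[R]_(m, n)) (B : 'M[R]_(m, p)) (C : 'M[R]_(n, p)) :
  mxdot (A^T *m B) C = mxdot A (B *m C^T).
Proof.
by rewrite (mxdotC A) (mxdot_mulmx B) trmxK !mxdot_trace trmx_mul trmxK mulmxA.
Qed.

Lemma trmx_mul_increment m n p (A C : 'M[R]_(m, n)) (V1 V2 : 'M[R]_(m, p)) :
  A^T *m V1 - C^T *m V2 = (A - C)^T *m V1 + C^T *m (V1 - V2).
Proof. by rewrite (raddfB trmx) mulmxBl mulmxBr addrA subrK. Qed.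

Lemma frobE m n (A : 'M[R]_(m, n)) : frob A = Num.sqrt (mxdot A A).
Proof. by []. Qed.

Lemma frob_ge0 m n (A : 'M[R]_(m, n)) : 0 <= frob A.
Proof. exact: sqrtr_ge0. Qed.

Lemma frob_sqr m n (A : 'M[R]_(m, n)) : frob A ^+ 2 = mxdot A A.
Proof. by rewrite frobE sqr_sqrtr// mxdot_ge0. Qed.

Lemma frob0 m n : frob (0 : 'M[R]_(m, n)) = 0.
Proof. by rewrite frobE -(scale0r 0) mxdotZl mul0r sqrtr0. Qed.

Lemma frobZ m n a (A : 'M[R]_(m, n)) : frob (a *: A) = `|a| * frob A.
Proof.
by rewrite !frobE mxdotZl mxdotZr mulrA sqrtrM ?sqrtr_sqr// -expr2 sqr_ge0.
Qed.

Lemma frobN m n (A : 'M[R]_(m, n)) : frob (- A) = frob A.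
Proof. by rewrite -scaleN1r frobZ normrN1 mul1r. Qed.

(** Discriminant argument, isolated because it yields Cauchy-Schwarz both for matrices and for
    expectations. *)
Lemma quadratic_ge0_le (a b c : R) : 0 <= a -> 0 <= c ->
  (forall l, 0 <= a + 2 * l * b + l ^+ 2 * c) -> b <= Num.sqrt a * Num.sqrt c.
Proof.
move=> a0 c0 h; rewrite -sqrtrM//.
apply: (le_trans (ler_norm _)); rewrite -sqrtr_sqr ler_wsqrtr//.
(* For [c = 0] the form is affine in [l], and the test value below would make it [-1] unless
   [b = 0]; otherwise [l = - b / c] is the minimizer. *)
have [c0'|cn0] := eqVneq c 0.
  have [->|bn0] := eqVneq b 0; first by rewrite expr0n/= mulr_ge0.
  have := h (- (a + 1) / (2 * b)); rewrite c0' mulr0 addr0.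
  suff -> : 2 * (- (a + 1) / (2 * b)) * b = - (a + 1) by lra.
  by field.
have := h (- b / c); suff -> : a + 2 * (- b / c) * b + (- b / c) ^+ 2 * c = (a * c - b ^+ 2) / c.
  by rewrite pmulr_lge0 ?subr_ge0 ?invr_gt0 // lt_neqAle eq_sym cn0.
by field.
Qed.

Lemma mxdot_le m n (A B : 'M[R]_(m, n)) : mxdot A B <= frob A * frob B.
Proof.
rewrite !frobE; apply: quadratic_ge0_le => [||l]; rewrite ?mxdot_ge0//.
have := mxdot_ge0 (A + l *: B).
by rewrite mxdotDl !mxdotDr !mxdotZl !mxdotZr (mxdotC B A) => /le_trans; apply; lra.
Qed.

Lemma mxdot_norm_le m n (A C : 'M[R]_(m, n)) : `|mxdot A C| <= frob A * frob C.
Proof. by rewrite ler_norml lerNl -mxdotNl -(frobN A) mxdot_le frobN mxdot_le. Qed.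

(** Norm bounds are obtained by duality: the matrix is tested against itself and one factor of its
    norm is cancelled. For an expectation, this avoids moving the norm under the integral. *)
Lemma frob_le_dot m n (A : 'M[R]_(m, n)) (c : R) : 0 <= c ->
  mxdot A A <= c * frob A -> frob A <= c.
Proof.
move=> c0; rewrite -frob_sqr expr2.
have [->//|A0] := eqVneq (frob A) 0.
by rewrite ler_pM2r// lt_neqAle eq_sym A0 frob_ge0.
Qed.

Lemma ler_entry_frob m n (A : 'M[R]_(m, n)) i j : `|A i j| <= frob A.
Proof.
rewrite -sqrtr_sqr ler_wsqrtr// (bigD1 i)//= (bigD1 j)//= -addrA lerDl.
by rewrite addr_ge0// sumr_ge0// => k _; [rewrite sqr_ge0|apply: sumr_ge0 => l _; rewrite sqr_ge0].
Qed.

(** The constant [m * n] is crude: the lemma serves only for qualitative boundedness. The absolute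
    value spares knowing the sign of [K]. *)
Lemma ler_frob_entry m n (A : 'M[R]_(m, n)) (K : R) :
  (forall i j, `|A i j| <= K) -> frob A <= (m * n)%:R * `|K|.
Proof.
move=> AK; apply: (@le_trans _ _ (Num.sqrt (((m * n)%:R * `|K|) ^+ 2))); last first.
  by rewrite sqrtr_sqr ger0_norm// mulr_ge0// normr_ge0.
apply: ler_wsqrtr; apply: (@le_trans _ _ (\sum_(i < m) \sum_(j < n) `|K| ^+ 2)).
  apply: ler_sum => i _; apply: ler_sum => j _.
  by rewrite -real_normK ?num_real// ler_pXn2r ?nnegrE// (le_trans (AK i j))// ler_norm.
rewrite (eq_bigr (fun=> `|K| ^+ 2 *+ n)); last by move=> i _; rewrite sumr_const card_ord.
rewrite sumr_const card_ord -mulrnA (mulnC n) -[leLHS]mulr_natl exprMn.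
rewrite ler_wpM2r ?sqr_ge0//.
by rewrite -natrX ler_nat; case: (m * n)%N => // k; rewrite expnS leq_pmulr// expn_gt0.
Qed.

Lemma frob_mul_tr m n (A : 'cV[R]_m) (B : 'cV[R]_n) :
  frob (A *m B^T) = frob A * frob B.
Proof.
rewrite /frob -sqrtrM; last by apply: sumr_ge0 => i _; apply: sumr_ge0 => j _; rewrite sqr_ge0.
congr Num.sqrt; rewrite mulr_suml; apply: eq_bigr => i _.
rewrite big_ord1 mulr_sumr; apply: eq_bigr => j _.
by rewrite !mxE !big_ord1 mxE exprMn.
Qed.

Lemma frob_mulmx_col m n (A : 'M[R]_(m, n)) (v : 'cV[R]_n) :
  frob (A *m v) <= frob A * frob v.
Proof.
apply: frob_le_dot; first by rewrite mulr_ge0 ?frob_ge0.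
rewrite mxdot_mulmx; apply: le_trans (mxdot_le _ _) _.
by rewrite frob_mul_tr -mulrA (mulrC (frob v)).
Qed.

Lemma opnorm_has_sup m n (A : 'M[R]_(m, n)) :
  has_sup [set frob (A *m v) | v in [set v : 'cV[R]_n | frob v <= 1]].
Proof.
split; first by exists (frob (A *m (0 : 'cV[R]_n))), 0 => //=; rewrite frob0.
exists (frob A) => _ [v /= v1 <-]; apply: le_trans (frob_mulmx_col _ _) _.
by rewrite ler_piMr// frob_ge0.
Qed.

Lemma opnorm_ge0 m n (A : 'M[R]_(m, n)) : 0 <= opnorm A.
Proof.
apply: (le_trans (frob_ge0 (A *m (0 : 'cV[R]_n)))); apply: sup_upper_bound (opnorm_has_sup A) _ _.
by exists 0 => //=; rewrite frob0.
Qed.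

Lemma opnorm_le_frob m n (A : 'M[R]_(m, n)) : opnorm A <= frob A.
Proof.
apply: ge_sup; first by case: (opnorm_has_sup A).
move=> _ [v /= v1 <-]; apply: le_trans (frob_mulmx_col _ _) _.
by rewrite ler_piMr// frob_ge0.
Qed.

Lemma frob_eq0 m n (A : 'M[R]_(m, n)) : frob A = 0 -> A = 0.
Proof.
move=> A0; apply/matrixP => i j; by have := ler_entry_frob A i j; rewrite A0 normr_le0 mxE => /eqP.
Qed.

Lemma frob_mulmx_opnorm m n (A : 'M[R]_(m, n)) (v : 'cV[R]_n) :
  frob (A *m v) <= opnorm A * frob v.
Proof.
have [v0|vn0] := eqVneq (frob v) 0.
  by rewrite (frob_eq0 v0) mulmx0 !frob0 mulr0.
have vgt0 : 0 < frob v by rewrite lt_neqAle eq_sym vn0 frob_ge0.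
rewrite -ler_pdivrMr//; apply: sup_upper_bound (opnorm_has_sup A) _ _.
exists ((frob v)^-1 *: v) => /=.
  by rewrite frobZ gtr0_norm ?invr_gt0// mulVf.
by rewrite -scalemxAr frobZ gtr0_norm ?invr_gt0// mulrC.
Qed.

Lemma frob_delta_cV n (j : 'I_n) : frob (delta_mx j 0 : 'cV[R]_n) = 1.
Proof.
rewrite /frob (bigD1 j)//= big_ord1 mxE !eqxx expr1n big1 ?addr0 ?sqrtr1// => i ij.
by rewrite big_ord1 mxE (negbTE ij) expr0n.
Qed.

(** Each column of [A] is the image of a unit vector, so its norm is at most [opnorm A]; summing [n]
    squares gives the factor. This is the origin of the [sqrt 3] in the final bounds. *)
Lemma frob_le_opnorm m n (A : 'M[R]_(m, n)) : frob A <= Num.sqrt n%:R * opnorm A.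
Proof.
rewrite -[X in _ <= _ * X]ger0_norm ?opnorm_ge0// -sqrtr_sqr -sqrtrM//.
apply: ler_wsqrtr; rewrite exchange_big/=.
apply: (@le_trans _ _ (\sum_(j < n) opnorm A ^+ 2)); last first.
  by rewrite sumr_const card_ord mulr_natl.
apply: ler_sum => j _.
have /ler_pXn2r : (0 < 2)%N by [].
move/(_ R _ _ (frob_ge0 (A *m delta_mx j (0 : 'I_1))) (opnorm_ge0 A)) => h.
have := frob_mulmx_opnorm A (delta_mx j (0 : 'I_1)); rewrite frob_delta_cV mulr1 -h.
rewrite frob_sqr; apply: le_trans; rewrite le_eqVlt; apply/orP; left; apply/eqP.
by apply: eq_bigr => i _; rewrite big_ord1 -colE mxE expr2.
Qed.

End Frobenius.

(** * Expectations of bounded random matrices *)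

Section BoundedRandomVariables.
Variables (R : realType) (d : measure_display) (Omega : measurableType d).
Variable P : probability Omega R.

(** [Ex] is the finite part of an extended expectation, linear a priori only on integrable
    functions. Boundedness, unlike integrability, is stable under products, so all the algebra is
    done in this class. *)
Definition bounded_rv (f : Omega -> R) :=
  measurable_fun setT f /\ exists K, forall w, `|f w| <= K.

Lemma bounded_rv_cst c : bounded_rv (fun=> c).
Proof. by split; [exact: measurable_cst|exists `|c|]. Qed.

Lemma bounded_rvD f g : bounded_rv f -> bounded_rv g ->
  bounded_rv (fun w => f w + g w).
Proof.
move=> [mf [Kf fK]] [mg [Kg gK]]; split; first exact: measurable_funD.
by exists (Kf + Kg) => w; apply: le_trans (ler_normD _ _) (lerD _ _).
Qed.

Lemma bounded_rvM f g : bounded_rv f -> bounded_rv g ->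
  bounded_rv (fun w => f w * g w).
Proof.
move=> [mf [Kf fK]] [mg [Kg gK]]; split; first exact: measurable_funM.
by exists (Kf * Kg) => w; rewrite normrM ler_pM.
Qed.

Lemma bounded_rvN f : bounded_rv f -> bounded_rv (fun w => - f w).
Proof.
move=> bf; have := bounded_rvM (bounded_rv_cst (-1)) bf.
by congr bounded_rv; apply/funext => w; rewrite mulN1r.
Qed.

Lemma bounded_rv_sum (I : finType) (f : I -> Omega -> R) :
  (forall i, bounded_rv (f i)) -> bounded_rv (fun w => \sum_i f i w).
Proof.
move=> bf; elim: (index_enum I) => [|i r ih].
  by under eq_fun do rewrite big_nil; exact: bounded_rv_cst.
by under eq_fun do rewrite big_cons; exact: bounded_rvD.
Qed.

Lemma bounded_rv_integrable f : bounded_rv f -> P.-integrable setT (EFin \o f).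
Proof.
move=> [mf [K fK]]; apply: measurable_bounded_integrable => //=.
  by rewrite probability_setT ltry.
exists K; split; first exact: num_real.
by move=> x Kx w _ /=; rewrite (le_trans (fK w))// ltW.
Qed.

Lemma Ex_Rintegral f : Ex P f = Rintegral P setT f.
Proof. by rewrite /Ex unlock. Qed.

Lemma ExD f g : bounded_rv f -> bounded_rv g ->
  Ex P (fun w => f w + g w) = Ex P f + Ex P g.
Proof.
by move=> bf bg; rewrite !Ex_Rintegral RintegralD//; exact: bounded_rv_integrable.
Qed.

Lemma ExZ c f : bounded_rv f -> Ex P (fun w => c * f w) = c * Ex P f.
Proof.
by move=> bf; rewrite !Ex_Rintegral RintegralZl//; exact: bounded_rv_integrable.
Qed.

Lemma ExB f g : bounded_rv f -> bounded_rv g ->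
  Ex P (fun w => f w - g w) = Ex P f - Ex P g.
Proof.
by move=> bf bg; rewrite !Ex_Rintegral RintegralB//; exact: bounded_rv_integrable.
Qed.

Lemma Ex_cst c : Ex P (fun=> c) = c.
Proof. by rewrite /Ex expectation_cst. Qed.

Lemma Ex_sum (I : finType) (f : I -> Omega -> R) : (forall i, bounded_rv (f i)) ->
  Ex P (fun w => \sum_i f i w) = \sum_i Ex P (f i).
Proof.
move=> bf; suff: forall r : seq I, bounded_rv (fun w => \sum_(i <- r) f i w) /\
    Ex P (fun w => \sum_(i <- r) f i w) = \sum_(i <- r) Ex P (f i).
  by move=> /(_ (index_enum I)) [].
elim=> [|i r [ih1 ih2]].
  by under eq_fun do rewrite big_nil; rewrite big_nil Ex_cst; split=> //; exact: bounded_rv_cst.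
under eq_fun do rewrite big_cons.
by rewrite big_cons ExD// ih2; split=> //; exact: bounded_rvD.
Qed.

Lemma Ex_ge0 f : (forall w, 0 <= f w) -> 0 <= Ex P f.
Proof. by move=> f0; rewrite fine_ge0// expectation_ge0. Qed.

Lemma Ex_le f g : bounded_rv f -> bounded_rv g -> (forall w, f w <= g w) ->
  Ex P f <= Ex P g.
Proof. by move=> bf bg fg; rewrite -subr_ge0 -ExB// Ex_ge0// => w; rewrite subr_ge0. Qed.

Definition bounded_rm m n (Y : Omega -> 'M[R]_(m, n)) :=
  forall i j, bounded_rv (fun w => Y w i j).

Lemma bounded_rm_cst m n (A : 'M[R]_(m, n)) : bounded_rm (fun=> A).
Proof. by move=> i j; exact: bounded_rv_cst. Qed.

Lemma bounded_rmB m n (A B : Omega -> 'M[R]_(m, n)) :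
  bounded_rm A -> bounded_rm B -> bounded_rm (fun w => A w - B w).
Proof.
move=> bA bB i j; under eq_fun do rewrite !mxE.
by apply: bounded_rvD => //; exact: bounded_rvN.
Qed.

Lemma bounded_rm_mul m n p (A : Omega -> 'M[R]_(m, n)) (B : Omega -> 'M[R]_(n, p)) :
  bounded_rm A -> bounded_rm B -> bounded_rm (fun w => A w *m B w).
Proof.
move=> bA bB i j; under eq_fun do rewrite mxE.
by apply: bounded_rv_sum => k; exact: bounded_rvM.
Qed.

Lemma bounded_rm_tr m n (A : Omega -> 'M[R]_(m, n)) :
  bounded_rm A -> bounded_rm (fun w => (A w)^T).
Proof. by move=> bA i j; under eq_fun do rewrite mxE. Qed.

Lemma bounded_rv_mxdot m n (A B : Omega -> 'M[R]_(m, n)) :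
  bounded_rm A -> bounded_rm B -> bounded_rv (fun w => mxdot (A w) (B w)).
Proof.
move=> bA bB; apply: bounded_rv_sum => i; apply: bounded_rv_sum => j.
exact: bounded_rvM.
Qed.

Lemma mxdot_Emx m n (Y : Omega -> 'M[R]_(m, n)) C : bounded_rm Y ->
  mxdot (Emx P Y) C = Ex P (fun w => mxdot (Y w) C).
Proof.
move=> bY; have bYC i j : bounded_rv (fun w => Y w i j * C i j).
  by apply: bounded_rvM => //; exact: bounded_rv_cst.
rewrite Ex_sum => [|i]; last exact: bounded_rv_sum.
apply: eq_bigr => i _; rewrite Ex_sum//; apply: eq_bigr => j _.
by under eq_fun do rewrite mulrC; rewrite ExZ// mxE mulrC.
Qed.

(** Constants leave the expectation, so the subtracted product is absorbed by centring [J]; centring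
    one factor suffices. *)
Lemma Emx_trmul_centered m n p (J : Omega -> 'M[R]_(m, n)) (V : Omega -> 'M[R]_(m, p)) :
  bounded_rm J -> bounded_rm V ->
  Emx P (fun w => (J w)^T *m V w) - (Emx P J)^T *m Emx P V =
  Emx P (fun w => (J w - Emx P J)^T *m V w).
Proof.
move=> bJ bV; apply/matrixP => i j; rewrite !mxE.
have bJV k : bounded_rv (fun w => J w k i * V w k j) by exact: bounded_rvM.
have bMV k : bounded_rv (fun w => Ex P (fun w => J w k i) * V w k j).
  by apply: bounded_rvM => //; exact: bounded_rv_cst.
under [in RHS]eq_fun do rewrite mxE.
under eq_fun do rewrite mxE.
rewrite !Ex_sum => [|k|k]; last 2 first.
- under eq_fun do rewrite !mxE mulrBl.
  by apply: bounded_rvD => //; exact: bounded_rvN.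
- by under eq_fun do rewrite mxE.
rewrite -sumrB; apply: eq_bigr => k _.
under eq_fun do rewrite mxE.
under [in RHS]eq_fun do rewrite !mxE mulrBl.
by rewrite ExB// !mxE ExZ.
Qed.

Local Notation L2 Y := (Num.sqrt (Ex P (fun w => frob (Y w) ^+ 2))).

(** Cauchy-Schwarz in L^2, from the discriminant of the nonnegative polynomial
    [l |-> E |A + l B|^2]. *)
Lemma Ex_mxdot_le m n (A B : Omega -> 'M[R]_(m, n)) :
  bounded_rm A -> bounded_rm B ->
  Ex P (fun w => mxdot (A w) (B w)) <=
  L2 A * L2 B.
Proof.
move=> bA bB; apply: quadratic_ge0_le => [||l]; try by apply: Ex_ge0 => w; rewrite sqr_ge0.
have -> : (fun w => frob (A w) ^+ 2) = (fun w => mxdot (A w) (A w)).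
  by apply/funext => w; rewrite frob_sqr.
have -> : (fun w => frob (B w) ^+ 2) = (fun w => mxdot (B w) (B w)).
  by apply/funext => w; rewrite frob_sqr.
have bd := bounded_rv_mxdot; have bc := bounded_rv_cst.
rewrite -!ExZ -?ExD; try by repeat (apply: bounded_rvD || apply: bounded_rvM
  || exact: bd || exact: bc).
apply: Ex_ge0 => w; have := mxdot_ge0 (A w + l *: B w).
by rewrite mxdotDl !mxdotDr !mxdotZl !mxdotZr (mxdotC (B w)) => /le_trans; apply; lra.
Qed.

Lemma L2_sqr m n (Y : Omega -> 'M[R]_(m, n)) : L2 Y ^+ 2 = Ex P (fun w => frob (Y w) ^+ 2).
Proof. by rewrite sqr_sqrtr// Ex_ge0// => w; rewrite sqr_ge0. Qed.

Lemma bounded_rv_frob2 m n (Y : Omega -> 'M[R]_(m, n)) :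
  bounded_rm Y -> bounded_rv (fun w => frob (Y w) ^+ 2).
Proof. by move=> bY; under eq_fun do rewrite frob_sqr; exact: bounded_rv_mxdot. Qed.

Lemma L2_mul_tr_le m n (Y : Omega -> 'cV[R]_m) (v : 'cV[R]_n) (c : R) : 0 <= c ->
  bounded_rm Y -> L2 Y <= c -> L2 (fun w => Y w *m v^T) <= c * frob v.
Proof.
move=> c0 bY Yc; have -> : (fun w => frob (Y w *m v^T) ^+ 2) =
    (fun w => frob v ^+ 2 * frob (Y w) ^+ 2).
  by apply/funext => w; rewrite frob_mul_tr exprMn mulrC.
rewrite ExZ; last exact: bounded_rv_frob2.
rewrite sqrtrM ?sqr_ge0// sqrtr_sqr ger0_norm ?frob_ge0// mulrC.
by rewrite ler_wpM2r// frob_ge0.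
Qed.

Lemma L2_le m n (Y : Omega -> 'M[R]_(m, n)) (c : R) : 0 <= c ->
  bounded_rm Y -> (forall w, frob (Y w) <= c) -> L2 Y <= c.
Proof.
move=> c0 bY Yc; rewrite -(ger0_norm c0) -sqrtr_sqr ler_wsqrtr// -[leRHS]Ex_cst.
apply: Ex_le => [||w]; [exact: bounded_rv_frob2|exact: bounded_rv_cst|].
by rewrite ler_pXn2r// nnegrE// frob_ge0.
Qed.

Lemma L2_scale_le m n p q (Y : Omega -> 'M[R]_(m, n)) (Z : Omega -> 'M[R]_(p, q)) (c : R) :
  0 <= c -> bounded_rm Y -> bounded_rm Z -> (forall w, frob (Y w) <= c * frob (Z w)) ->
  L2 Y <= c * L2 Z.
Proof.
move=> c0 bY bZ YZ; rewrite -[X in X * _](ger0_norm c0) -sqrtr_sqr -sqrtrM ?sqr_ge0//.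
rewrite ler_wsqrtr// -ExZ; last exact: bounded_rv_frob2.
apply: Ex_le => [||w].
- exact: bounded_rv_frob2.
- by apply: bounded_rvM; [exact: bounded_rv_cst|exact: bounded_rv_frob2].
- by rewrite -exprMn ler_pXn2r// nnegrE ?mulr_ge0// frob_ge0.
Qed.

Lemma L2_triangle m n (Y Z : Omega -> 'M[R]_(m, n)) : bounded_rm Y -> bounded_rm Z ->
  L2 (fun w => Y w + Z w) <= L2 Y + L2 Z.
Proof.
move=> bY bZ; rewrite -[leRHS]ger0_norm ?addr_ge0 ?sqrtr_ge0// -sqrtr_sqr ler_wsqrtr//.
have -> : (fun w => frob (Y w + Z w) ^+ 2) =
    (fun w => frob (Y w) ^+ 2 + (2 * mxdot (Y w) (Z w) + frob (Z w) ^+ 2)).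
  apply/funext => w; rewrite !frob_sqr mxdotDl !mxdotDr (mxdotC (Z w) (Y w)); ring.
have bYZ := bounded_rv_mxdot bY bZ.
have b2 : bounded_rv (fun w => 2 * mxdot (Y w) (Z w)).
  by apply: bounded_rvM => //; exact: bounded_rv_cst.
have bY2 := bounded_rv_frob2 bY; have bZ2 := bounded_rv_frob2 bZ.
rewrite ExD//; last exact: bounded_rvD.
rewrite ExD//; rewrite ExZ//; rewrite -[in leLHS](L2_sqr Y) -[in leLHS](L2_sqr Z).
have := Ex_mxdot_le bY bZ.
by move: (L2 Y) (L2 Z) (Ex P (fun w => mxdot (Y w) (Z w))) => a b c; lra.
Qed.

End BoundedRandomVariables.

(** * Measurability and null sets *)

Section NullModification.
Variables (R : realType) (d : measure_display) (T : measurableType d).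
Variable mu : {measure set T -> \bar R}.
Import HBNNSimple.

(* [f] and [g] are not assumed measurable: the integral is a supremum over the
   simple functions below the integrand, which may be cut off on [N] *)
Lemma ge0_integral_eq_off_null_le (N : set T) (f g : T -> \bar R) :
  measurable N -> mu N = 0%E -> (forall x, (0 <= f x)%E) -> (forall x, (0 <= g x)%E) ->
  (forall x, ~ N x -> f x = g x) -> (\int[mu]_x f x <= \int[mu]_x g x)%E.
Proof.
move=> mN N0 f0 g0 fg; rewrite !ge0_integralTE//.
apply: ge_ereal_sup => _ [h /= hf <-].
have mCN : measurable (setT `\` N) by exact: measurableD.
have -> : sintegral mu h = sintegral mu (proj_nnsfun h mCN).
  have -> : sintegral mu h = (\int[mu]_x (h x)%:E)%E.
    by rewrite integral_nnsfun// patch_setT.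
  rewrite -mrestrict -integral_nnsfun//.
  apply: ge0_negligible_integral => //; last by move=> x _; rewrite lee_fin.
  by apply/measurable_EFinP.
apply: ereal_sup_ubound; exists (proj_nnsfun h mCN) => // x /=.
rewrite mindicE; case: (boolP (x \in _)) => [xN|_]; last by rewrite mulr0.
rewrite mulr1 -fg//; by move: xN; rewrite inE => -[].
Qed.

Lemma integral_eq_off_null (N : set T) (f g : T -> \bar R) :
  measurable N -> mu N = 0%E -> (forall x, ~ N x -> f x = g x) ->
  (\int[mu]_x f x = \int[mu]_x g x)%E.
Proof.
move=> mN N0 fg; rewrite integralE [RHS]integralE; congr (_ - _)%E.
  apply/eqP; rewrite eq_le; apply/andP; split;
    by apply: (ge0_integral_eq_off_null_le mN) => // x Nx; rewrite !funeposE fg.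
apply/eqP; rewrite eq_le; apply/andP; split;
  by apply: (ge0_integral_eq_off_null_le mN) => // x Nx; rewrite !funenegE fg.
Qed.

End NullModification.

Lemma Ex_eq_off_null (R : realType) d (Omega : measurableType d)
    (P : probability Omega R) (N : set Omega) (f g : Omega -> R) :
  measurable N -> P N = 0%E -> (forall w, ~ N w -> f w = g w) -> Ex P f = Ex P g.
Proof.
move=> mN N0 fg; rewrite /Ex unlock; congr fine.
by apply: (integral_eq_off_null mN) => // w /fg ->.
Qed.

(** The preimage of an open ray under [f] is open, hence the union of the countably many rational
    boxes that it contains; lying in a box amounts to finitely many measurable conditions on
    coordinates. *)
Lemma measurable_fun_continuous_cV (R : realType) d (Omega : measurableType d) n
    (f : 'cV[R]_n -> R) (Y : Omega -> 'cV[R]_n) :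
  continuous f -> (forall i, measurable_fun setT (fun w => Y w i 0)) ->
  measurable_fun setT (fun w => f (Y w)).
Proof.
move=> cf mY mT; apply: (measurability _ (RGenOInfty.measurableE R)) => //.
move=> /= _ [_ [a ->] <-].
pose box (q : 'cV[rat]_n * nat) :=
  [set v : 'cV[R]_n | forall i, `|ratr (q.1 i 0) - v i 0| < q.2.+1%:R^-1].
pose U := f @^-1` `]a, +oo[.
have oU : open U by apply: open_comp => [x _|]; [exact: cf|exact: interval_open].
pose F q := [set w | box q `<=` U /\ box q (Y w)].
rewrite setTI (_ : _ @^-1` _ = \bigcup_q F q); last first.
  apply/seteqP; split=> [w Uw|w [q _ [qU qw]]]; last exact: (qU (Y w)).
  have : nbhs (Y w) U by exact: open_nbhs_nbhs.
  move=> /nbhs_ballP[e /= e0 eU].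
  (* The rational centre will lie within [r] of [Y w], so the box of half-width [r] stays within
     [2 r < e] of [Y w]. *)
  have [k ke] : exists k : nat, 2 * k.+1%:R^-1 < e.
    have e20 : 0 < e / 2 by rewrite divr_gt0.
    have [k _ /(_ _ (leqnn _)) kP] := near_infty_natSinv_lt (PosNum e20).
    by exists k; rewrite mulrC -ltr_pdivlMr.
  have k0 : 0 < k.+1%:R^-1 :> R by rewrite invr_gt0.
  set r := k.+1%:R^-1 in ke k0.
  have /choice[q qP] : forall i, exists s : rat, `|ratr s - Y w i 0| < r.
    move=> i; have /rat_in_itvoo[s] : Y w i 0 - r < Y w i 0 + r by lra.
    by rewrite in_itv/= => /andP[s1 s2]; exists s; rewrite ltr_norml; apply/andP; split; lra.
  exists (\col_i q i, k) => //; split=> [v|i] /=; last by rewrite mxE.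
  move=> qv; apply: eU; split=> // i j; rewrite (ord1 j) /ball/=.
  have := qv i; rewrite mxE/= -/r => qvi; have := qP i => qi.
  rewrite -(subrKA (ratr (q i))) (le_lt_trans (ler_normD _ _))//.
  by rewrite (distrC (Y w i 0)); lra.
apply: countable_bigcupT_measurable => [|q]; first exact: countableP.
(* The inclusion in [U] does not depend on [w]: if it fails, the event [F q] is empty. *)
have [qU|qU] := pselect (box q `<=` U); last first.
  by rewrite (_ : F q = set0)//; apply/seteqP; split => // w [].
rewrite (_ : F q = \bigcap_(i in [set: 'I_n])
    [set w | `|ratr (q.1 i 0) - Y w i 0| < q.2.+1%:R^-1]); last first.
  by apply/seteqP; split => [w [_ qw] i _|w qw]; [exact: qw|split=> // i; exact: qw].
rewrite -bigsetI_fset_set ?fset_setT//; last exact: finite_finset.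
apply: bigsetI_measurable => i _.
have mq : measurable_fun setT (fun w => `|ratr (q.1 i 0) - Y w i 0|).
  by apply: measurableT_comp => //; apply: measurable_funB => //; exact: measurable_cst.
rewrite (_ : [set _ | _] = setT `&`
    (fun w => `|ratr (q.1 i 0) - Y w i 0|) @^-1` `]-oo, q.2.+1%:R^-1[%classic).
  by apply: mq => //; exact: measurable_itv.
by rewrite setTI; apply/seteqP; split => w /=; rewrite in_itv.
Qed.

(** * Gradients and Lipschitz maps *)

Section DirectionalCalculus.
Variable R : realType.
Local Notation R3 := 'cV[R]_3.
Implicit Types v : R3 -> R3.

Lemma differentiable_entry_derivable v x h i :
  differentiable v x -> derivable (fun y => v y i 0 : R^o) x h.
Proof. by move=> /(@diff_derivable _ _ _ _ _ h) /derivable_mxP; apply. Qed.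

Lemma grad_mulmx v x h : differentiable v x -> grad v x *m h = 'D_h v x.
Proof.
move=> dv; rewrite deriveE// {2}(matrix_sum_delta h) linear_sum/=.
under [RHS]eq_bigr do rewrite big_ord1 linearZ/= -deriveE//.
apply/matrixP => i k; rewrite mxE summxE (ord1 k); apply: eq_bigr => j _.
by rewrite !mxE mulrC derive_mx ?mxE//; exact: diff_derivable.
Qed.

Lemma is_derive_line (W : normedModType R) (f : R3 -> W) y h (s : R) :
  derivable f (y + s *: h) h ->
  is_derive s 1 (fun r : R^o => f (y + r *: h)) ('D_h f (y + s *: h)).
Proof.
have E : (fun r : R^o => r^-1 *:
    (((fun q : R^o => f (y + q *: h)) \o shift s) (r *: 1) - f (y + s *: h)))
  = (fun r : R => r^-1 *: ((f \o shift (y + s *: h)) (r *: h) - f (y + s *: h))).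
  apply/funext => r /=; rewrite (_ : r *: (1 : R^o) = r); last exact: mulr1.
  by rewrite scalerDl addrCA.
by move=> dfh; apply: DeriveDef; rewrite /derivable /derive E.
Qed.

(** Pairing with a fixed vector gives a real function along the segment, to which the mean value
    theorem applies; that theorem fails for vector values. *)
Lemma is_derive_mxdot_line v y h (Z : R3) (s : R) :
  (forall x, differentiable v x) ->
  is_derive (s : R^o) 1 (fun r => mxdot (v (y + r *: h)) Z : R^o)
    (mxdot (grad v (y + s *: h) *m h) Z).
Proof.
move=> dv.
have D i : is_derive (s : R^o) 1 (Z i 0 \*: (fun r : R^o => v (y + r *: h) i 0 : R^o))
    (Z i 0 *: ('D_h v (y + s *: h) i 0 : R^o)).
  apply: is_deriveZ; rewrite derive_mx ?mxE; last exact: diff_derivable.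
  exact/(is_derive_line (f := fun y => v y i 0 : R^o))/differentiable_entry_derivable.
have := is_derive_sum D.
rewrite (_ : \sum_(i < 3) _ = (fun r : R^o => mxdot (v (y + r *: h)) Z : R^o)); last first.
  apply/funext => r; rewrite fct_sumE; apply: eq_bigr => i _.
  by rewrite big_ord1 mulrC.
move=> /is_derive_eq; apply; rewrite grad_mulmx//.
by apply: eq_bigr => i _; rewrite big_ord1 mulrC.
Qed.

Lemma derive_le_increment (f : R -> R) (C : R) :
  (forall s : R, derivable f s 1) -> (forall s : R, 'D_1 f s <= C) -> f 1 - f 0 <= C.
Proof.
move=> df fC; have [x _||c _ ->] := MVT_segment (f := f) (df := fun s => 'D_1 f s) (@ler01 R).
- exact/derivableP.
- exact: derivable_within_continuous.
- by rewrite subr0 mulr1.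
Qed.

(** Mean value theorem for the pairing with [v a - v b], whose increment is the square of the norm
    to be bounded. *)
Lemma opnorm_grad_lipschitz v (G : R) : (forall x, differentiable v x) ->
  (forall x, opnorm (grad v x) <= G) -> forall a b, frob (v a - v b) <= G * frob (a - b).
Proof.
move=> dv vG a b; have G0 : 0 <= G by apply: le_trans (vG 0); exact: opnorm_ge0.
apply: frob_le_dot; first by rewrite mulr_ge0// frob_ge0.
have D s := is_derive_mxdot_line b (a - b) (v a - v b) s dv.
have := @derive_le_increment (fun r => mxdot (v (b + r *: (a - b))) (v a - v b))
  (G * frob (a - b) * frob (v a - v b)).
rewrite scale1r scale0r addr0 addrCA subrr addr0 -mxdotBl; apply => s.
  exact: (@ex_derive _ _ _ _ _ _ _ (D s)).
rewrite (@derive_val _ _ _ _ _ _ _ (D s)); apply: le_trans (mxdot_le _ _) _.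
rewrite ler_wpM2r ?frob_ge0//; apply: le_trans (frob_mulmx_opnorm _ _) _.
by rewrite ler_wpM2r ?frob_ge0.
Qed.

(** The steps run through the sequence [1 / (n + 1)]: a sequential limit preserves measurability in
    [w], and Lipschitz bounds pass to it. *)
Definition diff_quotient v x i j (n : nat) : R :=
  n.+1%:R * (v (n.+1%:R^-1 *: delta_mx j 0 + x) i 0 - v x i 0).

Lemma diff_quotient_cvg v x i j : differentiable v x ->
  diff_quotient v x i j n @[n --> \oo] --> grad v x i j.
Proof.
move=> dv; rewrite mxE.
have /cvgr_dnbhsP := @differentiable_entry_derivable v x (delta_mx j 0) i dv.
move=> /(_ (fun n => n.+1%:R^-1)).
rewrite /diff_quotient; under [X in _ -> X @ _ --> _]eq_fun do rewrite -[X in X * _]invrK.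
apply; split; first by move=> n; rewrite invr_eq0 pnatr_eq0.
exact: cvg_harmonic.
Qed.

Lemma lipschitz_grad_entry v (K : R) x i j : differentiable v x ->
  (forall a b, frob (v a - v b) <= K * frob (a - b)) -> `|grad v x i j| <= K.
Proof.
move=> dv vK; have := cvg_norm (@diff_quotient_cvg v x i j dv); move=> /(_ _) C.
rewrite -(cvg_lim _ C)//; apply: limr_le; first by apply/cvg_ex; eexists; exact: C.
apply: nearW => n; rewrite normrM ger0_norm//.
have := ler_entry_frob (v (n.+1%:R^-1 *: delta_mx j 0 + x) - v x) i 0.
rewrite !mxE => /le_trans/(_ (vK _ _)); rewrite addrK frobZ.
rewrite (@gtr0_norm _ n.+1%:R^-1) ?invr_gt0// frob_delta_cV mulr1 => h.
by rewrite -ler_pdivlMl// mulrC.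
Qed.

End DirectionalCalculus.

(** * Fields on the torus *)

Section PeriodicFields.
Variable R : realType.
Local Notation R3 := 'cV[R]_3.

Lemma Zvec_reduction (x : R3) : exists k, forall i, 0 <= (x - Zvec R k) i 0 <= 1.
Proof.
exists (\col_i Num.floor (x i 0)) => i; rewrite !mxE subr_ge0 floor_le/=.
by have := ltW (floorD1_gt (x i 0)); rewrite intrD lerBlDr addrC.
Qed.

(* Continuity is only required on the slab, which the compact set
   [0, T] x [0, 1]^3 (encoded in 'rV_4) covers up to translations. *)
Lemma periodic_slab_bounded (T : R) (f : R^o * R3 -> R) :
  (forall z : R^o * R3, 0 <= (z.1 : R) <= T -> {for z, continuous f}) ->
  (forall s, 0 <= s <= T -> periodic (fun x => f (s, x))) ->
  exists C, forall s x, 0 <= s <= T -> `|f (s, x)| <= C.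
Proof.
move=> cf pf.
pose A (i : 'I_4) : set R := if i == 0 then `[0, T]%classic else `[0, 1]%classic.
pose g (v : 'rV[R]_4) : R^o * R3 := (v 0 0, \col_i v 0 (lift 0 i)).
have cg : continuous g.
  move=> v O /nbhs_ballP[e e0 eO]; apply/nbhs_ballP; exists e => // v' [_ vv'].
  apply: eO.
  split; first exact: vv'.
  by split => // i j; rewrite !mxE; exact: vv'.
have cK : compact [set v : 'rV[R]_4 | forall i, A i (v ord0 i)].
  by apply: rV_compact => i; rewrite /A; case: ifP => _; exact: segment_compact.
have := continuous_compact _ cK => /(_ _ (f \o g)) cfg.
have {}cfg : compact ((f \o g) @` [set v : 'rV[R]_4 | forall i, A i (v ord0 i)]).
  apply: cfg; apply: continuous_in_subspaceT => v; rewrite inE/= => Av.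
  apply: continuous_comp; first exact: cg.
  by apply: cf; have := Av 0; rewrite /A eqxx/= in_itv.
have [C [_ CP]] := compact_bounded cfg.
exists (`|C| + 1) => s x sT.
have [k xk] := Zvec_reduction x.
have -> : f (s, x) = f (s, x - Zvec R k).
  by rewrite -(pf s sT (x - Zvec R k) k) subrK.
apply: (CP (`|C| + 1)); first by rewrite ltr_pwDr// ler_norm.
exists (\row_j (if unlift 0 j is Some i then (x - Zvec R k) i 0 else s)).
  move=> j; rewrite mxE /A; case: unliftP => [i ->|->].
    by rewrite -[_ == _]/false/= in_itv/=; exact: xk.
  by rewrite eqxx/= in_itv.
rewrite /= /g; congr f; congr pair; first by rewrite mxE unlift_none.
by apply/matrixP => i j; rewrite !mxE liftK (ord1 j) !mxE.
Qed.

(** Equal difference quotients give equal derivatives, with no differentiability assumed. The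
    domains may differ, so this covers both lattice translations and the restriction to a time
    slice. *)
Lemma derive_congr (E1 E2 W : normedModType R) (f : E1 -> W) (g : E2 -> W) a v b w :
  (forall h, f (h *: v + a) = g (h *: w + b)) -> f a = g b -> 'D_v f a = 'D_w g b.
Proof.
move=> fg fagb; rewrite /derive (_ : (fun h : R => h^-1 *: ((f \o shift a) (h *: v) - f a))
  = (fun h => h^-1 *: ((g \o shift b) (h *: w) - g b)))//.
by apply/funext => h /=; rewrite fg fagb.
Qed.

Lemma periodic_grad (v : R3 -> R3) : periodic v -> periodic (grad v).
Proof.
move=> pv x k; apply/matrixP => i j; rewrite !mxE; apply: derive_congr => [h|].
  by rewrite addrA pv.
by rewrite pv.
Qed.

Lemma slab_bounds (T : R) (u : R -> R3 -> R3) :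
  smooth_on [set z : R^o * R3 | 0 <= (z.1 : R) <= T] (fun z => u z.1 z.2) ->
  (forall s, 0 <= s <= T -> periodic (u s)) ->
  exists L U, forall s, 0 <= s <= T -> forall x,
    [/\ differentiable (u s) x, opnorm (grad (u s) x) <= L & frob (u s x) <= U].
Proof.
set S := [set z : R^o * R3 | _]; set F := fun z => u z.1 z.2.
move=> [D [oD SD FD]] pu.
have [dF cdF] := FD 1%N.
have du s x : 0 <= s <= T -> differentiable (u s) x.
  move=> sT; apply: (@differentiable_comp _ _ _ _ (fun y : R3 => ((s : R^o), y)) F).
    exact: differentiable_pair.
  by apply/dF/SD.
(* A space derivative of [u s] is the derivative of the joint field [F] in the direction [(0, e_j)],
   hence jointly continuous, and [periodic_slab_bounded] applies to it. *)
have dE s x j : 0 <= s <= T ->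
    'D_((0 : R^o), delta_mx j 0 : R3) F (s, x) = 'D_(delta_mx j 0) (u s) x.
  by move=> sT; apply: derive_congr => // h; rewrite /F/= scaler0 add0r.
have gE s x i j : 0 <= s <= T ->
    grad (u s) x i j = 'D_((0 : R^o), delta_mx j 0 : R3) F (s, x) i 0.
  move=> sT; rewrite dE// derive_mx; last exact/diff_derivable/du.
  by rewrite !mxE.
have centry i : continuous (fun N : R3 => N i 0).
  by move=> N; apply/differentiable_continuous/differentiable_coord.
have /choice[Ug UgP] : forall ij : 'I_3 * 'I_3, exists C, forall s x, 0 <= s <= T ->
    `|grad (u s) x ij.1 ij.2| <= C.
  move=> [i j]; have [z zS|s sT x k|C CP] := @periodic_slab_bounded T
    (fun z => 'D_((0 : R^o), delta_mx j 0 : R3) F z i 0).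
  - apply: (@continuous_comp _ _ _ ('D_((0 : R^o), delta_mx j 0 : R3) F) (fun N : R3 => N i 0)).
      exact/cdF/SD.
    exact: centry.
  - by rewrite -!gE// periodic_grad//; exact: pu.
  - by exists C => s x sT /=; rewrite gE//; exact: CP.
have /choice[Uu UuP] : forall i : 'I_3, exists C, forall s x, 0 <= s <= T ->
    `|u s x i 0| <= C.
  move=> i; have [z zS|s sT x k|C CP] := @periodic_slab_bounded T (fun z => F z i 0).
  - apply: (@continuous_comp _ _ _ F (fun N : R3 => N i 0)); last exact: centry.
    exact/differentiable_continuous/dF/SD.
  - by rewrite /F/= pu.
  - by exists C => s x sT; exact: CP.
(* The sum of all entrywise bounds dominates each of them; 9 and 3 are the numbers of entries in
   [ler_frob_entry]. *)
exists (9%:R * `|\sum_ij `|Ug ij| |), (3%:R * `|\sum_i `|Uu i| |) => s sT x; split.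
- exact: du.
- apply: le_trans (opnorm_le_frob _) _; apply: (@ler_frob_entry _ 3 3) => i j.
  apply: le_trans (UgP (i, j) s x sT) _; apply: le_trans (ler_norm _) _.
  by rewrite (bigD1 (i, j))//= lerDl sumr_ge0.
- apply: (@ler_frob_entry _ 3 1) => i j; rewrite (ord1 j).
  apply: le_trans (UuP i s x sT) _; apply: le_trans (ler_norm _) _.
  by rewrite (bigD1 i)//= lerDl sumr_ge0.
Qed.

Lemma tdist_ge0 (x y : R3) : 0 <= tdist x y.
Proof.
apply: lb_le_inf; first by exists (frob (x - y - Zvec R 0)), 0.
by move=> _ [k _ <-]; exact: frob_ge0.
Qed.

Lemma tdist_le1 (x y : R3) : tdist x y <= 1.
Proof.
(* The shift by 1/2 puts [x - y - k] in the cube [[-1/2, 1/2]^3], where the squared norm is at most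
   3/4. *)
have [k kP] := Zvec_reduction (x - y + const_mx (2^-1)).
apply: (@le_trans _ _ (frob (x - y - Zvec R k))).
  apply: ge_inf; last by exists k.
  by exists 0 => _ [l _ <-]; exact: frob_ge0.
rewrite -sqrtr1 ler_wsqrtr//.
apply: (@le_trans _ _ (\sum_(i < 3) 4^-1)); last first.
  by rewrite sumr_const card_ord -mulr_natl; lra.
apply: ler_sum => i _; rewrite big_ord1.
have := kP i; rewrite addrAC mxE [X in _ + X]mxE; move: ((x - y - Zvec R k) i 0) => a h.
by nra.
Qed.

(** A bound valid for every lattice representative passes to the infimum [tdist], without exhibiting
    a minimizer. *)
Lemma le_tdist_affine (x y : R3) (r a c : R) : 0 <= c ->
  (forall k, r <= a + c * frob (x - y - Zvec R k)) -> r <= a + c * tdist x y.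
Proof.
move=> c0 h; have [c0'|cn0] := eqVneq c 0.
  by have := h 0; rewrite c0' !mul0r.
have cp : 0 < c by rewrite lt_neqAle eq_sym cn0.
rewrite -lerBlDl mulrC -ler_pdivrMr//.
apply: lb_le_inf; first by exists (frob (x - y - Zvec R 0)), 0.
by move=> _ [k _ <-]; rewrite ler_pdivrMr// mulrC lerBlDl.
Qed.

End PeriodicFields.

(** Replaces an extended supremum by a real number dominating every value, so that the estimates can
    be run in [R]. *)
Lemma ereal_sup_bounded (R : realType) (T : pointedType) (g : T -> R) (C : R) :
  (forall x, 0 <= g x <= C) ->
  exists c : R, [/\ 0 <= c, ereal_sup (range (fun x => (g x)%:E)) = c%:E &
    forall x, g x <= c].
Proof.
move=> gC; set e := ereal_sup _.
have ge x : ((g x)%:E <= e)%E by apply: ereal_sup_ubound; exists x.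
have eC : (e <= C%:E)%E.
  by apply: ge_ereal_sup => _ [x _ <-]; rewrite lee_fin; case/andP: (gC x).
have e0 : (0 <= e)%E by apply: le_trans (ge point); rewrite lee_fin; case/andP: (gC point).
have ef : e \is a fin_num by rewrite ge0_fin_numE// (le_lt_trans eC)// ltry.
by exists (fine e); split=> [||x]; [exact: fine_ge0|rewrite fineK|rewrite -lee_fin fineK].
Qed.

(** * Backward Gronwall inequality *)

Section BackwardGronwall.
Variable R : realType.
Local Notation R3 := 'cV[R]_3.

Lemma within_continuous_along (T : R) (F : R^o * R3 -> R3) (x : R -> R3) i :
  (forall z : R^o * R3, 0 <= (z.1 : R) <= T -> {for z, continuous F}) ->
  {within `[0, T], continuous x} ->
  {within `[0, T], continuous (fun s => F (s, x s) i 0)}.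
Proof.
move=> cF /subspace_continuousP cx; apply/subspace_continuousP => s sT.
have sT' : 0 <= s <= T by move: sT; rewrite /= in_itv.
have cp : (r, x r) @[r --> within `[0, T]%classic (nbhs s)] --> ((s, x s) : R^o * R3).
  apply: (@cvg_pair _ _ _ _ (nbhs (s : R^o)) (nbhs (x s))); last exact: cx.
  exact: cvg_within.
apply: (cvg_comp _ (fun N : R3 => N i 0)); last first.
  exact: (differentiable_continuous (@differentiable_coord R 3 1 (F (s, x s)) i 0)).
apply: (cvg_comp _ F cp); exact: cF.
Qed.

(* Since the noise is additive it cancels in the difference of two
   trajectories, which is therefore C^1 in time, and
   [frob (x1 s - x2 s) ^ 2 * exp (2 L s)] is nondecreasing. *)
Lemma backward_gronwall (T L : R) (F : R^o * R3 -> R3) (a1 a2 : R3) (x1 x2 c : R -> R3) :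
  (forall z : R^o * R3, 0 <= (z.1 : R) <= T -> {for z, continuous F}) ->
  (forall s, 0 <= s <= T -> forall x y, frob (F (s, x) - F (s, y)) <= L * frob (x - y)) ->
  {within `[0, T], continuous x1} -> {within `[0, T], continuous x2} ->
  (forall t, 0 <= t <= T -> x1 t = a1 +
    \col_i (\int[lebesgue_measure]_(s in `[0, t]) F (s, x1 s) i 0) + c t) ->
  (forall t, 0 <= t <= T -> x2 t = a2 +
    \col_i (\int[lebesgue_measure]_(s in `[0, t]) F (s, x2 s) i 0) + c t) ->
  forall t, 0 <= t <= T ->
    frob (a1 - a2) <= Num.sqrt (expR (2 * L * t)) * frob (x1 t - x2 t).
Proof.
move=> cF lipF cx1 cx2 e1 e2 t /andP[t0 tT].
pose f k i s : R := F (s, (if k then x1 else x2) s) i 0.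
have cf k i : {within `[0, T], continuous (f k i)}.
  by case: k; exact: within_continuous_along.
have intf k i : lebesgue_measure.-integrable `[0, T] (EFin \o f k i).
  exact/continuous_compact_integrable/cf/segment_compact.
pose I k i s : R := \int[lebesgue_measure]_(r in `[0, s]) f k i r.
(* The trajectories are only continuous in time; [E] is their difference with [c] already cancelled,
   hence differentiable inside []0, t[]. *)
pose E (s : R) : R3 := a1 - a2 + \col_i (I true i s - I false i s).
have ED s : 0 <= s <= T -> E s = x1 s - x2 s.
  move=> sT; rewrite e1// e2//; apply/matrixP => i j; rewrite !mxE /I /f/=.
  by set A := Rintegral _ _ _; set A' := Rintegral _ _ _; ring.
have T0 : 0 <= T := le_trans t0 tT.
have cI k i : {within `[0, t], continuous (I k i)}.
  apply: (@continuous_subspaceW _ _ _ `[0, T]).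
    by move=> s /=; rewrite !in_itv/= => /andP[-> /le_trans->].
  exact: parameterized_integral_continuous.
have dI k i s : s \in `]0, t[ -> is_derive s 1 (I k i) (f k i s).
  rewrite in_itv/= => /andP[s0 st].
  have sT : s < T := lt_le_trans st tT.
  have [||dd de] := continuous_FTC1 sT (intf k i).
  - by rewrite lte_fin.
  - apply: (within_continuous_continuous (lt_trans s0 sT) (cf k i)).
    by rewrite in_itv/= s0.
  by apply: DeriveDef; [exact: dd|rewrite -derive1E; exact: de].
pose e i (s : R) : R := (a1 - a2) i 0 + (I true i s - I false i s).
have eE i s : e i s = E s i 0 by rewrite /E [in RHS]mxE [in X in _ + X]mxE.
have de i s : s \in `]0, t[ -> is_derive s 1 (e i) (f true i s - f false i s).
  move=> st; have d1 := dI true i s st; have d2 := dI false i s st.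
  have := is_deriveD (is_derive_cst ((a1 - a2) i 0 : R^o) (s : R^o) 1) (is_deriveB d1 d2).
  by rewrite add0r.
have ce i : {within `[0, t], continuous (e i)}.
  by move=> s; rewrite /e; apply: cvgD; [exact: cvg_cst|apply: cvgB; exact: cI].
pose q i s := e i s ^+ 2 * expR (2 * L * s).
have dq i s : s \in `]0, t[ -> is_derive s 1 (q i)
    (expR (2 * L * s) * (2 * (e i s * (f true i s - f false i s)) + 2 * L * e i s ^+ 2)).
  move=> st; have d1 := de i s st.
  have dl : is_derive (s : R) 1 (fun r : R => 2 * L * r) (2 * L).
    have := is_deriveZ (2 * L) (is_derive_id (s : R^o) 1).
    by rewrite /GRing.scale/= mulr1.
  have dx := is_derive1_comp (is_derive_expR (2 * L * s)) dl.
  have := is_deriveM (is_deriveX 2 d1) dx.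
  move=> /is_derive_eq; apply.
  rewrite /GRing.scale/= expr1 (_ : (e i ^+ 2) s = e i s ^+ 2)//; ring.
have cq i : {within `[0, t], continuous (q i)}.
  move=> s; rewrite /q; apply: cvgM.
    by apply: (@cvg_comp _ _ _ (e i) (fun r => r ^+ 2)); [exact: ce|exact: exprn_continuous].
  have cexp : continuous (fun r : R => expR (2 * L * r)).
    move=> r; apply: (@continuous_comp _ _ _ (fun r => 2 * L * r) expR).
      exact: mulrl_continuous.
    exact: continuous_expR.
  exact: (continuous_subspaceT cexp).
pose p s := \sum_i q i s.
have pE s : p s = mxdot (E s) (E s) * expR (2 * L * s).
  by rewrite mulr_suml; apply: eq_bigr => i _; rewrite big_ord1 /q eE expr2.
have dp s : s \in `]0, t[ -> is_derive s 1 p (\sum_i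
    (expR (2 * L * s) * (2 * (e i s * (f true i s - f false i s)) + 2 * L * e i s ^+ 2))).
  move=> st; have := is_derive_sum (fun i => dq i s st).
  by congr is_derive; apply/funext => r; rewrite fct_sumE.
have cp : {within `[0, t], continuous p}.
  by move=> s; rewrite /p; apply: cvg_big => [|i _]; [exact: add_continuous|exact: cq].
have p0t : p 0 <= p t.
  apply: (@ger0_derive1_ndecr _ p 0 t _ _ cp) => // s st.
    exact: (@ex_derive _ _ _ _ _ _ _ (dp s st)).
  rewrite derive1E (@derive_val _ _ _ _ _ _ _ (dp s st)) -mulr_sumr mulr_ge0 ?expR_ge0//.
  have sT : 0 <= s <= T.
    by move: st; rewrite in_itv/= => /andP[/ltW-> /ltW /le_trans->].
  pose D : R3 := F (s, x1 s) - F (s, x2 s).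
  have -> : \sum_i (2 * (e i s * (f true i s - f false i s)) + 2 * L * e i s ^+ 2) =
      2 * (mxdot (E s) D + L * mxdot (E s) (E s)).
    rewrite /mxdot mulr_sumr -big_split/= mulr_sumr; apply: eq_bigr => i _.
    rewrite !big_ord1 !eE (_ : D i 0 = f true i s - f false i s); last by rewrite !mxE.
    by ring.
  (* By Cauchy-Schwarz and the Lipschitz bound on [F], [mxdot (E s) D] is at least [- L |E s|^2];
     the exponential weight compensates exactly this. *)
  rewrite mulr_ge0// addrC -[mxdot _ D]opprK -mxdotNl subr_ge0.
  apply: le_trans (mxdot_le _ _) _; rewrite frobN mulrC -frob_sqr expr2 mulrA.
  by rewrite ler_wpM2r ?frob_ge0// ED// lipF.
have E0 : E 0 = a1 - a2.
  apply/matrixP => i j; rewrite !mxE /I set_itv1 !Rintegral_set1; ring.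
move: p0t; rewrite !pE mulr0 expR0 mulr1 E0 ED ?t0// mulrC => /ler_wsqrtr.
by rewrite sqrtrM ?expR_ge0.
Qed.

End BackwardGronwall.

(** * The estimates for a regular Lipschitz flow *)

Section LipschitzFlowFields.
Variables (R : realType) (d : measure_display) (Omega : measurableType d).
Variable P : probability Omega R.
Local Notation R3 := 'cV[R]_3.
Variables (u0 : R3 -> R3) (B : Omega -> R3 -> R3) (K U G : R).
Hypothesis mB : forall x, random_vector (fun w => B w x).
Hypothesis dB : forall w x, differentiable (B w) x.
Hypothesis lipB : forall w a b, frob (B w a - B w b) <= K * frob (a - b).
Hypothesis torusB : forall w, torus_map (B w).
Hypothesis du0 : forall x, differentiable u0 x.
Hypothesis peru0 : periodic u0.
Hypothesis u0U : forall x, frob (u0 x) <= U.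
Hypothesis u0G : forall x, opnorm (grad u0 x) <= G.

Local Notation L2 Y := (Num.sqrt (Ex P (fun w => frob (Y w) ^+ 2))).

Let J := Jf B.
Let V := Vf u0 B.
Let M := Mf P B.

Lemma bounded_increment x y : bounded_rm (fun w => B w x - B w y).
Proof.
move=> i j; rewrite (ord1 j); split.
  under eq_fun do rewrite !mxE.
  by apply: measurable_funB; exact: mB.
by exists (K * frob (x - y)) => w; apply: le_trans (ler_entry_frob _ _ _) (lipB _ _ _).
Qed.

(** The gradient is a pointwise limit of difference quotients, measurable in [w] since [B] is at
    each fixed point; the bound is the Lipschitz constant common to all [w]. *)
Lemma bounded_grad x : bounded_rm (J x).
Proof.
move=> i j; split; last first.
  by exists K => w; exact: lipschitz_grad_entry (dB w x) (lipB w).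
apply: (@measurable_fun_cvg _ _ _ _ (fun n w => diff_quotient (B w) x i j n)) => [n|w _].
  by apply: measurable_funM; [exact: measurable_cst|apply: measurable_funB; exact: mB].
exact: diff_quotient_cvg.
Qed.

Lemma bounded_datum x : bounded_rm (V x).
Proof.
move=> i j; rewrite (ord1 j); split; last first.
  by exists U => w; apply: le_trans (ler_entry_frob _ _ _) (u0U _).
apply: (@measurable_fun_continuous_cV _ _ _ _ (fun a => u0 a i 0) (fun w => B w x)).
  move=> a; apply: (@continuous_comp _ _ _ u0 (fun N : R3 => N i 0)).
    exact: differentiable_continuous.
  exact/differentiable_continuous/differentiable_coord.
by move=> k; exact: mB.
Qed.

Lemma bounded_Jtilde x : bounded_rm (Jtilde P B x).
Proof. by apply: bounded_rmB; [exact: bounded_grad|exact: bounded_rm_cst]. Qed.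

Lemma Qf_trace x : \tr (Qf P B x) = Ex P (fun w => frob (Jtilde P B x w) ^+ 2).
Proof.
have bJ := bounded_Jtilde x.
have bQ := bounded_rm_mul (bounded_rm_tr bJ) bJ.
under [in RHS]eq_fun do rewrite frob_sqr mxdot_trace.
rewrite -[in RHS]/(Ex P (fun w => \sum_i ((Jtilde P B x w)^T *m Jtilde P B x w) i i)).
by rewrite Ex_sum//; apply: eq_bigr => i _; rewrite mxE.
Qed.

Lemma L2_grad_le x : L2 (J x) <= L2 (Jtilde P B x) + frob (M x).
Proof.
under eq_fun do rewrite -(subrK (M x) (J x _)).
apply: le_trans (L2_triangle P (bounded_Jtilde x) (bounded_rm_cst Omega (M x))) _.
rewrite lerD2l; apply: L2_le; [exact: frob_ge0|exact: bounded_rm_cst|by []].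
Qed.

(* Tested against the increment [Z = B x - B y] itself, the expectation of the
   increment along the segment is differentiable; this avoids Minkowski's
   integral inequality for the joint integral over segment and [Omega]. *)
Lemma L2_increment_le (S : R) : 0 <= S -> (forall x, L2 (J x) <= S) ->
  forall x y, L2 (fun w => B w x - B w y) <= S * frob (x - y).
Proof.
move=> S0 JS x y; pose h : R3 := x - y; pose Z w : R3 := B w x - B w y.
have bZ : bounded_rm Z := bounded_increment x y.
(* No sign of [K] is assumed: it is read off the Lipschitz bound at a sample point, whence the
   argument [w]. *)
have K0 (w : Omega) : 0 <= K * frob h.
  exact: le_trans (frob_ge0 _) (lipB w x y).
pose f (s : R) w := mxdot (B w (y + s *: h) - B w y) (Z w).
have bf s : bounded_rv (f s) by apply: bounded_rv_mxdot => //; exact: bounded_increment.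
have df s w : is_derive (s : R^o) 1 (f ^~ w) (mxdot (J (y + s *: h) w *m h) (Z w)).
  have := is_deriveD (is_derive_mxdot_line y h (Z w) s (dB w))
    (is_derive_cst (- mxdot (B w y) (Z w) : R^o) (s : R^o) 1).
  rewrite addr0; congr is_derive; apply/funext => r.
  by rewrite /f mxdotBl.
have d1f s w : partial1of2 f s w = mxdot (J (y + s *: h) w *m h) (Z w).
  by rewrite partial1of2E; exact: (@derive_val _ _ _ _ _ _ _ (df s w)).
(* Deterministic domination for differentiating under the expectation; the first factor bounds the
   gradient through its nine entries. *)
pose C := (9%:R * `|K|) * frob h * (K * frob h).
have fC s w : `|partial1of2 f s w| <= C.
  rewrite d1f; apply: le_trans (mxdot_norm_le _ _) _.
  apply: ler_pM; rewrite ?frob_ge0//; last exact: lipB.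
  apply: le_trans (frob_mulmx_col _ _) _; rewrite ler_wpM2r ?frob_ge0//.
  apply: (@ler_frob_entry _ 3 3) => i j.
  exact: lipschitz_grad_entry (dB w _) (lipB w).
have C0 (w : Omega) : 0 <= C.
  by apply: mulr_ge0 (K0 w); rewrite mulr_ge0 ?frob_ge0// mulr_ge0.
have iC : P.-integrable setT (EFin \o fun=> C).
  exact/bounded_rv_integrable/bounded_rv_cst.
(* Differentiation under the integral is local: any bounded open interval around [s] would do. *)
have sI (s : R) : [set` `]s - 1, s + 1[] s.
  by rewrite /= in_itv/= ltrBlDr ltrDl ltr01.
have iF (s r : R) : [set` `]s - 1, s + 1[] r -> P.-integrable setT (EFin \o f r).
  by move=> _; exact/bounded_rv_integrable.
have dF (s r : R) (w : Omega) : [set` `]s - 1, s + 1[] r -> setT w -> derivable (f ^~ w) r 1.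
  by move=> _ _; exact: (@ex_derive _ _ _ _ _ _ _ (df r w)).
have GF (s r : R) (w : Omega) : [set` `]s - 1, s + 1[] r -> setT w -> `|partial1of2 f r w| <= C.
  by move=> _ _; exact: fC.
have EfE : (fun s => Ex P (f s)) = (fun s => Rintegral P setT (f s)).
  by apply/funext => s; rewrite Ex_Rintegral.
have := @derive_le_increment R (fun s => Ex P (f s)) (S * (frob h * L2 Z)).
rewrite {1 2}EfE => inc.
have {inc} : Ex P (f 1) - Ex P (f 0) <= S * (frob h * L2 Z).
  apply: inc => s.
    exact: (derivable_under_integral measurableT (sI s) (iF s) (dF s) C0 iC (GF s)).
  rewrite -derive1E.
  rewrite (differentiation_under_integral measurableT (sI s) (iF s) (dF s) C0 iC (GF s)).
  (* The derivative is [E <J h, Z> = E <J, Z h^T>]; Cauchy-Schwarz in L^2 separates [J] from the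
     increment [Z]. *)
  rewrite -Ex_Rintegral; under eq_fun do rewrite d1f mxdot_mulmx.
  have bZh : bounded_rm (fun w => Z w *m h^T).
    by apply: bounded_rm_mul => //; exact: bounded_rm_cst.
  apply: le_trans (Ex_mxdot_le P (bounded_grad _) bZh) _.
  apply: ler_pM; rewrite ?sqrtr_ge0 ?JS// mulrC.
  by apply: L2_mul_tr_le => //; rewrite sqrtr_ge0.
(* As [f] is 0 at 0 and [|Z|^2] at 1, the inequality reads [L2 Z ^+ 2 <= S * frob h * L2 Z], and one
   factor cancels. *)
have -> : f 0 = cst 0.
  by apply/funext => w; rewrite /f scale0r addr0 subrr -(scale0r 0) mxdotZl mul0r.
rewrite Ex_cst subr0 (_ : f 1 = fun w => frob (Z w) ^+ 2); last first.
  by apply/funext => w; rewrite /f scale1r addrCA subrr addr0 frob_sqr.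
rewrite -{1}L2_sqr mulrA expr2.
have [->|Z0] := eqVneq (L2 Z) 0.
  by move=> _; rewrite mulr_ge0// frob_ge0.
by rewrite ler_pM2r// lt_neqAle eq_sym Z0 sqrtr_ge0.
Qed.

Lemma calR_centered x : calR P u0 B x = Emx P (fun w => (Jtilde P B x w)^T *m V x w).
Proof. exact: Emx_trmul_centered (bounded_grad x) (bounded_datum x). Qed.

Lemma U_ge0 : 0 <= U.
Proof. exact: le_trans (frob_ge0 _) (u0U 0). Qed.

(** [E[Y^T W]] paired with [v] is [E <Y, W v^T>], to which Cauchy-Schwarz applies. Both the sup
    bound and the two terms of the increment reduce to this. *)
Lemma Emx_trmul_dot_le (Y : Omega -> 'M[R]_3) (W : Omega -> R3) (v : R3) (c : R) :
  bounded_rm Y -> bounded_rm W -> 0 <= c -> L2 W <= c ->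
  mxdot (Emx P (fun w => (Y w)^T *m W w)) v <= L2 Y * c * frob v.
Proof.
move=> bY bW c0 Wc; rewrite mxdot_Emx; last first.
  by apply: bounded_rm_mul => //; exact: bounded_rm_tr.
under eq_fun do rewrite mxdot_trmulmx.
have bWv : bounded_rm (fun w => W w *m v^T).
  by apply: bounded_rm_mul => //; exact: bounded_rm_cst.
apply: le_trans (Ex_mxdot_le P bY bWv) _.
by rewrite -mulrA ler_wpM2l ?sqrtr_ge0//; exact: L2_mul_tr_le.
Qed.

Lemma calR_le x : frob (calR P u0 B x) <= U * Num.sqrt (\tr (Qf P B x)).
Proof.
rewrite Qf_trace mulrC; apply: frob_le_dot; first by rewrite mulr_ge0 ?sqrtr_ge0 ?U_ge0.
rewrite {1}calR_centered; apply: Emx_trmul_dot_le.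
- exact: bounded_Jtilde.
- exact: bounded_datum.
- exact: U_ge0.
- by apply: L2_le; [exact: U_ge0|exact: bounded_datum|move=> w; exact: u0U].
Qed.

Lemma calR_increment_le (S : R) : 0 <= S -> (forall x, L2 (J x) <= S) ->
  forall x y k, frob (calR P u0 B x - calR P u0 B y) <=
    U * L2 (fun w => Jtilde P B x w - Jtilde P B y w) +
    G * Num.sqrt (\tr (Qf P B y)) * S * frob (x - y - Zvec R k).
Proof.
move=> S0 JS x y k; rewrite Qf_trace.
set D := L2 (fun w => Jtilde P B x w - _); set s := L2 (Jtilde P B y).
have G0 : 0 <= G := le_trans (opnorm_ge0 _) (u0G 0).
have c0 : 0 <= G * (S * frob (x - y - Zvec R k)) by rewrite !mulr_ge0 ?frob_ge0.
(* Only [V] is moved to another representative of [y], where it is unchanged since [B w] commutes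
   with translations and [u0] is periodic; [Jtilde] stays at [y]. *)
have VE w : V y w = V (y + Zvec R k) w by rewrite /V/Vf torusB peru0.
apply: frob_le_dot.
  by rewrite addr_ge0 ?mulr_ge0 ?frob_ge0 ?sqrtr_ge0 ?U_ge0.
have bJ := bounded_Jtilde; have bV := bounded_datum.
have bDJ : bounded_rm (fun w => Jtilde P B x w - Jtilde P B y w) by exact: bounded_rmB.
have bDV : bounded_rm (fun w => V x w - V y w) by exact: bounded_rmB.
set v := calR P u0 B x - _.
have {1}-> : v = Emx P (fun w => (Jtilde P B x w - Jtilde P B y w)^T *m V x w) +
    Emx P (fun w => (Jtilde P B y w)^T *m (V x w - V y w)).
  rewrite /v !calR_centered; apply/matrixP => i j; rewrite !mxE.
  have bJV a b : bounded_rv (fun w => ((Jtilde P B a w)^T *m V b w) i j).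
    by apply: bounded_rm_mul => //; exact: bounded_rm_tr.
  rewrite -ExB// -ExD; last 2 first.
  - by move: i j {bJV}; apply: bounded_rm_mul => //; exact: bounded_rm_tr.
  - by move: i j {bJV}; apply: bounded_rm_mul => //; exact: bounded_rm_tr.
  have eD (N1 N2 : R3) : N1 i j + N2 i j = (N1 + N2) i j by rewrite mxE.
  have eB (N1 N2 : R3) : N1 i j - N2 i j = (N1 - N2) i j by rewrite !mxE.
  congr Ex; apply/funext => w.
  by rewrite eD eB trmx_mul_increment.
rewrite mxdotDl mulrDl lerD//.
  rewrite (mulrC U); apply: Emx_trmul_dot_le => //; first exact: U_ge0.
  by apply: L2_le; [exact: U_ge0|exact: bV|move=> w; exact: u0U].
rewrite (_ : G * s * S * _ = s * (G * (S * frob (x - y - Zvec R k)))); last by ring.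
apply: Emx_trmul_dot_le => //.
have := L2_increment_le S0 JS x (y + Zvec R k); rewrite opprD addrA => incr.
apply: le_trans (ler_wpM2l G0 incr).
apply: L2_scale_le => // [|w]; first exact: bounded_increment.
by rewrite VE; exact: opnorm_grad_lipschitz.
Qed.

Lemma tr_Qf_le_sigmaJ x : ((Num.sqrt (\tr (Qf P B x)))%:E <= sigmaJ P B)%E.
Proof. by apply: ereal_sup_ubound; exists x. Qed.

Lemma sigmaJ_ge0 : (0 <= sigmaJ P B)%E.
Proof. by apply: le_trans (tr_Qf_le_sigmaJ 0); rewrite lee_fin sqrtr_ge0. Qed.

Lemma LJ_le : (LJ P B <= sigmaJ P B + (Num.sqrt 3)%:E * supnorm (@opnorm R 3 3) M)%E.
Proof.
apply: ge_ereal_sup => _ [x _ <-].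
apply: (@le_trans _ _ ((Num.sqrt (\tr (Qf P B x)))%:E + (Num.sqrt 3)%:E * (opnorm (M x))%:E)%E).
  rewrite -EFinM -EFinD lee_fin Qf_trace; apply: le_trans (L2_grad_le x) _.
  by rewrite lerD2l; exact: frob_le_opnorm.
apply: leeD; first exact: tr_Qf_le_sigmaJ.
apply: lee_wpmul2l; first by rewrite lee_fin sqrtr_ge0.
by apply: ereal_sup_ubound; exists x.
Qed.

Lemma supnorm_calR_le : (supnorm (@frob R 3 1) (calR P u0 B) <= U%:E * sigmaJ P B)%E.
Proof.
apply: ge_ereal_sup => _ [x _ <-].
apply: (@le_trans _ _ (U%:E * (Num.sqrt (\tr (Qf P B x)))%:E)%E).
  by rewrite -EFinM lee_fin calR_le.
by apply: lee_wpmul2l; [rewrite lee_fin U_ge0|exact: tr_Qf_le_sigmaJ].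
Qed.

Lemma LJ_fin : exists S : R, [/\ 0 <= S, LJ P B = S%:E & forall x, L2 (J x) <= S].
Proof.
apply: (@ereal_sup_bounded _ _ _ (9%:R * `|K|)) => x; rewrite sqrtr_ge0/=.
apply: L2_le => [||w]; [by rewrite mulr_ge0|exact: bounded_grad|].
by apply: (@ler_frob_entry _ 3 3) => i j; exact: lipschitz_grad_entry (dB w x) (lipB w).
Qed.

Lemma holder_quotient_le (b : R) (z : R3 * R3) : 0 < b <= 1 -> ~ torus_eq z.1 z.2 ->
  ((frob (calR P u0 B z.1 - calR P u0 B z.2) / tdist z.1 z.2 `^ b)%:E <=
   U%:E * HJ P B b + G%:E * sigmaJ P B *
     (sigmaJ P B + (Num.sqrt 3)%:E * supnorm (@opnorm R 3 3) M))%E.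
Proof.
case: z => x y /= /andP[b0 b1] xy.
have [S [S0 LJE JS]] := LJ_fin.
have G0 : 0 <= G := le_trans (opnorm_ge0 _) (u0G 0).
set D := L2 (fun w => Jtilde P B x w - Jtilde P B y w).
set s := Num.sqrt (\tr (Qf P B y)); set t := tdist x y.
have DH : ((D / t `^ b)%:E <= HJ P B b)%E by apply: ereal_sup_ubound; exists (x, y).
have t0 : 0 <= t := tdist_ge0 x y.
have D0 : 0 <= D / t `^ b by rewrite mulr_ge0 ?sqrtr_ge0// invr_ge0 powR_ge0.
have c0 : 0 <= G * s * S by rewrite !mulr_ge0// sqrtr_ge0.
apply: (@le_trans _ _ (U%:E * (D / t `^ b)%:E + G%:E * s%:E * S%:E)%E); last first.
  apply: leeD; first by apply: lee_wpmul2l; rewrite ?lee_fin ?U_ge0.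
  rewrite -LJE; apply: lee_pmul; rewrite ?LJE ?mule_ge0 ?lee_fin ?sqrtr_ge0//.
    by apply: lee_wpmul2l; [rewrite lee_fin|exact: tr_Qf_le_sigmaJ].
  by rewrite -LJE; exact: LJ_le.
rewrite -!EFinM -EFinD lee_fin.
(* Distance 0 is not ruled out here for inequivalent points: both quotients are then 0 by the
   convention [0^-1 = 0]. *)
have [tz|tn0] := eqVneq t 0.
  rewrite tz powR0 ?gt_eqF// invr0 !mulr0 add0r//.
have tp : 0 < t by rewrite lt_neqAle eq_sym tn0.
have tbp : 0 < t `^ b by exact: powR_gt0.
(* Distances are at most 1 and [b <= 1], so the Lipschitz contribution of [V] is also a Hölder one,
   with no extra constant. *)
have ttb : t <= t `^ b.
  by rewrite -[leLHS]powRr1//; apply: ger_powR; rewrite // tp tdist_le1.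
rewrite ler_pdivrMr// mulrDl -(mulrA U) divfK ?gt_eqF//.
apply: (@le_trans _ _ (U * D + G * s * S * t)); last by rewrite lerD2l ler_wpM2l.
apply: le_tdist_affine => // k; exact: calR_increment_le.
Qed.

Lemma holder_norm_calR_le (b : R) : 0 < b <= 1 ->
  (holder_norm b (calR P u0 B) <=
   U%:E * (sigmaJ P B + HJ P B b) + G%:E * sigmaJ P B *
     (sigmaJ P B + (Num.sqrt 3)%:E * supnorm (@opnorm R 3 3) M))%E.
Proof.
move=> b01; rewrite /holder_norm.
(* A pair of inequivalent points gives [0 <= HJ], needed to distribute the product over the extended
   sum. Without any pair the seminorm is the supremum of the empty set, [-oo], and the bound is
   trivial. *)
have [[z zP]|none] := pselect (exists z : R3 * R3, ~ torus_eq z.1 z.2); last first.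
  rewrite /holder_seminorm (_ : [set z : R3 * R3 | _] = set0).
    by rewrite image_set0 ereal_sup0 addeNy leNye.
  by apply/seteqP; split => // z zP; apply: none; exists z.
have H0 : (0 <= HJ P B b)%E.
  apply: (@le_trans _ _ (Num.sqrt (Ex P (fun w => frob (Jtilde P B z.1 w - Jtilde P B z.2 w) ^+ 2))
          / tdist z.1 z.2 `^ b)%:E).
    by rewrite lee_fin mulr_ge0 ?sqrtr_ge0// invr_ge0 powR_ge0.
  by apply: ereal_sup_ubound; exists z.
rewrite ge0_muleDr ?sigmaJ_ge0// -addeA; apply: leeD; first exact: supnorm_calR_le.
by apply: ge_ereal_sup => _ [z' z'P <-]; exact: holder_quotient_le.
Qed.

End LipschitzFlowFields.

(** * Regular version of the inverse flow *)

Lemma smooth_on_differentiable (R : realType) (f : 'cV[R]_3 -> 'cV[R]_3) :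
  smooth_on setT f -> forall x, differentiable f x.
Proof. by move=> [D [_ TD /(_ 1%N) [df _]]] x; exact/df/TD. Qed.

(** Inverses are unique, so [A] is the smooth inverse [g]; it commutes with translations because [X]
    does. *)
Lemma inverse_torus_diffeo (R : realType) (X A : 'cV[R]_3 -> 'cV[R]_3) :
  smooth_vp_diffeo X -> cancel X A -> cancel A X ->
  torus_map A /\ forall x, differentiable A x.
Proof.
move=> [tX _ _ [g [Xg gX sg]]] XA AX; split=> [x k|].
  by rewrite -{1}(AX x) -tX XA.
have -> : A = g by apply/funext => x; rewrite -[in RHS](AX x) Xg.
exact: smooth_on_differentiable.
Qed.

Section NullModificationOfFields.
Variables (R : realType) (d : measure_display) (Omega : measurableType d).
Variable P : probability Omega R.
Local Notation R3 := 'cV[R]_3.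
Variables (N : set Omega) (u0 : R3 -> R3) (A B : Omega -> R3 -> R3).
Hypotheses (mN : measurable N) (PN : P N = 0%E) (AB : forall w, ~ N w -> A w = B w).

Lemma eq_Emx_off_null m n (Y Z : Omega -> 'M[R]_(m, n)) :
  (forall w, ~ N w -> Y w = Z w) -> Emx P Y = Emx P Z.
Proof.
move=> YZ; apply/matrixP => i j; rewrite !mxE.
by apply: (Ex_eq_off_null mN PN) => w /YZ ->.
Qed.

Lemma eq_Jf_off_null x w : ~ N w -> Jf A x w = Jf B x w.
Proof. by move=> Nw; rewrite /Jf AB. Qed.

Lemma eq_Mf_off_null : Mf P A = Mf P B.
Proof. by apply/funext => x; apply: eq_Emx_off_null => w /eq_Jf_off_null. Qed.

Lemma eq_Jtilde_off_null x w : ~ N w -> Jtilde P A x w = Jtilde P B x w.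
Proof. by move=> Nw; rewrite /Jtilde eq_Mf_off_null eq_Jf_off_null. Qed.

Lemma eq_calR_off_null : calR P u0 A = calR P u0 B.
Proof.
apply/funext => x; rewrite /calR eq_Mf_off_null; congr (_ - _).
  by apply: eq_Emx_off_null => w Nw; rewrite eq_Jf_off_null// /Vf AB.
by congr (_ *m _); apply: eq_Emx_off_null => w Nw; rewrite /Vf AB.
Qed.

Lemma eq_sigmaJ_off_null : sigmaJ P A = sigmaJ P B.
Proof.
have QE : Qf P A = Qf P B.
  apply/funext => x; apply: eq_Emx_off_null => w Nw.
  by rewrite eq_Jtilde_off_null.
by rewrite /sigmaJ QE.
Qed.

Lemma eq_LJ_off_null : LJ P A = LJ P B.
Proof.
have E x : Ex P (fun w => frob (Jf A x w) ^+ 2) = Ex P (fun w => frob (Jf B x w) ^+ 2).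
  by apply: (Ex_eq_off_null mN PN) => w Nw; rewrite eq_Jf_off_null.
apply: (congr1 (@ereal_sup R)); apply: eq_imagel => x _.
exact: (congr1 (fun e => (Num.sqrt e)%:E) (E x)).
Qed.

Lemma eq_HJ_off_null b : HJ P A b = HJ P B b.
Proof.
have E x y : Ex P (fun w => frob (Jtilde P A x w - Jtilde P A y w) ^+ 2) =
    Ex P (fun w => frob (Jtilde P B x w - Jtilde P B y w) ^+ 2).
  by apply: (Ex_eq_off_null mN PN) => w Nw; rewrite !eq_Jtilde_off_null.
apply: (congr1 (@ereal_sup R)); apply: eq_imagel => z _.
exact: (congr1 (fun e => (Num.sqrt e / tdist z.1 z.2 `^ b)%:E) (E z.1 z.2)).
Qed.

End NullModificationOfFields.

Lemma flow_regular_version (R : realType) (d : measure_display) (Omega : measurableType d)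
    (P : probability Omega R) (nu T : R) (u : R -> 'cV[R]_3 -> 'cV[R]_3)
    (W : R -> Omega -> 'cV[R]_3) (X A : R -> Omega -> 'cV[R]_3 -> 'cV[R]_3) (L t : R) :
  (forall z : R^o * 'cV[R]_3, 0 <= (z.1 : R) <= T ->
    {for z, continuous (fun z => u z.1 z.2)}) ->
  (forall s, 0 <= s <= T -> forall x y, frob (u s x - u s y) <= L * frob (x - y)) ->
  stochastic_flow P nu T u W X -> inverse_flow P T X A -> 0 <= t <= T ->
  exists (N : set Omega) (B : Omega -> 'cV[R]_3 -> 'cV[R]_3) (K : R),
    [/\ measurable N /\ P N = 0%E, forall w, ~ N w -> A t w = B w,
        forall x, random_vector (fun w => B w x),
        (forall w x, differentiable (B w) x) /\ (forall w, torus_map (B w)) &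
        forall w a b, frob (B w a - B w b) <= K * frob (a - b)].
Proof.
move=> cu lipu [_ flow vp] /(_ t)/[swap] tT /(_ tT) [mA inv].
have [N [mN PN NQ]] := filterI flow (filterI (vp t tT) inv).
have good w : ~ N w -> [/\ (forall a, {within `[0, T], continuous (fun t => X t w a)} /\
    forall t, 0 <= t <= T -> X t w a = a
      + \col_i (\int[lebesgue_measure]_(s in `[0, t]) u s (X s w a) i 0)
      + Num.sqrt (2 * nu) *: W t w), smooth_vp_diffeo (X t w),
    cancel (X t w) (A t w) & cancel (A t w) (X t w)].
  move=> Nw; have : ~ ~ _ := contra_not (NQ w) Nw.
  by move=> /contrapT [? [? []]].
pose B w := if w \in N then id else A t w.
(* The summand 1 is the Lipschitz constant of the identity, used on [N]; the other one is the
   Gronwall factor. *)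
pose K := 1 + Num.sqrt (expR (2 * L * t)).
exists N, B, K; split => //.
- by move=> w Nw; rewrite /B memNset.
- move=> x i.
  have -> : (fun w => B w x i 0) = (fun w => if w \in N then x i 0 else A t w x i 0).
    by apply/funext => w; rewrite /B; case: ifP.
  apply: measurable_fun_ifT; last exact: mA; last exact: measurable_cst.
  apply: (measurable_fun_bool true); rewrite setTI (_ : _ @^-1` _ = N)//.
  by apply/seteqP; split => w /=; [exact: set_mem|exact: mem_set].
- split=> w; rewrite /B; case: ifPn => [_|]; rewrite ?notin_setE => // Nw.
    have [_ sX XA AX] := good w Nw.
    by have [] := inverse_torus_diffeo sX XA AX.
  have [_ sX XA AX] := good w Nw.
  by have [] := inverse_torus_diffeo sX XA AX.
- move=> w a b; rewrite /B /K mulrDl mul1r; case: ifPn => [_|].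
    by rewrite lerDl mulr_ge0 ?sqrtr_ge0 ?frob_ge0.
  rewrite notin_setE => Nw; have [fl _ _ AX] := good w Nw.
  rewrite -{3}(AX a) -{3}(AX b).
  (* Gronwall is applied to the trajectories issued from [A t w a] and [A t w b], which reach [a]
     and [b] at time [t] under the same noise. *)
  apply: (@le_trans _ _ (Num.sqrt (expR (2 * L * t)) * frob (X t w (A t w a) - X t w (A t w b)))).
    have [ca ea] := fl (A t w a); have [cb eb] := fl (A t w b).
    exact: (backward_gronwall cu lipu ca cb ea eb tT).
  by rewrite !AX lerDr frob_ge0.
Qed.

(** * Transfer of the estimates to the inverse flow *)

Theorem proposition3p5 (R : realType) :
  exists C : R, 0 < C /\
  forall (d : measure_display) (Omega : measurableType d)
         (P : probability Omega R) (nu T : R)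
         (u0 : 'cV[R]_3 -> 'cV[R]_3) (u : R -> 'cV[R]_3 -> 'cV[R]_3)
         (W : R -> Omega -> 'cV[R]_3)
         (X A : R -> Omega -> 'cV[R]_3 -> 'cV[R]_3),
    0 < nu ->
    navier_stokes nu T u0 u ->
    brownian P W ->
    stochastic_flow P nu T u W X ->
    inverse_flow P T X A ->
    forall t : R, 0 <= t <= T ->
      let M := Mf P (A t) in
      let Rt := calR P u0 (A t) in
      let normu0 := supnorm (@frob R 3 1) u0 in
      let normgradu0 := supnorm (@opnorm R 3 3) (grad u0) in
      let normM := supnorm (@opnorm R 3 3) M in
      let sJ := sigmaJ P (A t) in
      [/\ (LJ P (A t) <= sJ + (Num.sqrt 3)%:E * normM)%E,
          (supnorm (@frob R 3 1) Rt <= normu0 * sJ)%E &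
          forall b : R, 0 < b <= 1 ->
            (holder_norm b Rt <=
               C%:E * (normu0 * (sJ + HJ P (A t) b)
                       + normgradu0 * sJ * (sJ + (Num.sqrt 3)%:E * normM)))%E].
Proof.
(* The Hölder estimate was obtained with constant 1. *)
exists 1; split=> // d Omega P nu T u0 u W X A _ [su pu _ _ u0E] _ flow inv t tT.
have T0 : 0 <= (0 : R) <= T.
  by rewrite lexx; case/andP: tT => /le_trans; apply.
have {u0E} -> : u0 = u 0 by apply/funext => x; rewrite u0E.
have [L [U uLU]] := slab_bounds su pu.
have lipu s : 0 <= s <= T -> forall x y, frob (u s x - u s y) <= L * frob (x - y).
  by move=> sT; apply: opnorm_grad_lipschitz => x; have [] := uLU s sT x.
have cu (z : R^o * 'cV[R]_3) : 0 <= (z.1 : R) <= T ->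
    {for z, continuous (fun z => u z.1 z.2)}.
  by move=> zT; have [D [_ SD /(_ 0%N)]] := su; apply; exact: SD.
have [N [B [K [[mN PN] AB mB [dB tB] lipB]]]] := flow_regular_version cu lipu flow inv tT.
have du0 x : differentiable (u 0) x by have [] := uLU 0 T0 x.
(* The crude slab bounds only ensure finiteness; the estimates are then applied with the exact
   suprema [U'] and [G], which are the norms in the statement. *)
have [|U' [U'0 U'E u0U]] := @ereal_sup_bounded R _ (fun x => frob (u 0 x)) U.
  by move=> x; rewrite frob_ge0/=; have [] := uLU 0 T0 x.
have [|G [G0 GE u0G]] := @ereal_sup_bounded R _ (fun x => opnorm (grad (u 0) x)) L.
  by move=> x; rewrite opnorm_ge0/=; have [] := uLU 0 T0 x.
rewrite /= (eq_Mf_off_null mN PN AB) (eq_calR_off_null _ mN PN AB).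
rewrite (eq_sigmaJ_off_null mN PN AB) (eq_LJ_off_null mN PN AB).
have -> : supnorm (@frob R 3 1) (u 0) = U'%:E by [].
have -> : supnorm (@opnorm R 3 3) (grad (u 0)) = G%:E by [].
split=> [||b b01].
- exact: LJ_le mB dB lipB.
- exact: supnorm_calR_le mB dB lipB du0 u0U.
- rewrite mul1e (eq_HJ_off_null mN PN AB).
  exact (holder_norm_calR_le P mB dB lipB tB du0 (pu 0 T0) u0U u0G b01).
Qed.
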